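(* Let $\Omega(B^\pm)=\Omega(B^+)\cup\Omega(B^-)$ be a polygonal Andreev billiard with phase space $(\Omega(B^\pm)\times S^1)/\!\sim_\pm$ and flow $\Phi_\pm^t$. The volume element $dx\wedge dy\wedge d\theta$ on $(\Omega(B^\pm)\times S^1)/\!\sim_\pm$ is not preserved under $\Phi_\pm^t$. Furthermore, for $\theta,\theta'\in S^1$, $(x,y)$ in the interior $\Omega(B^+)^\circ$, $(x',y')$ in the interior $\Omega(B^-)^\circ$ and $t>0$ such that $\Phi_\pm^t((x,y),\theta)=((x',y'),\theta')$, it is the case that $$dx'\wedge dy'\wedge d\theta'=-\,dx\wedge dy\wedge d\theta .$$
   Context: Polygonal Andreev billiard: let $\Omega(B^+)$ be a polygonal billiard, i.e. a compact region in the plane whose boundary $B^+$ is a polygon. Let $A^+\subseteq B^+$ be a nonempty connected $C^1$ subset which is a vertical segment of $B^+$ and contains no singularities (corners) of the billiard flow. Let $\rho$ be the reflection of the plane through a line parallel to $A^+$ that does not meet the interior of $\Omega(B^+)$, and put $\Omega(B^-)=\rho(\Omega(B^+))$, $B^-=\rho(B^+)$, $A^-=\rho(A^+)$. The regions $\Omega(B^+)$ and $\Omega(B^-)$ are regarded as two copies of a billiard table, and are glued along $A^+$ and $A^-$ according to the relation $\sim_\pm$ below. Write $\Omega(B^\pm)=\Omega(B^+)\cup\Omega(B^-)$ and $B^\pm=B^+\cup B^-$; $A^+\cup A^-$ is called the Andreev subset. Relation $\sim_\pm$: directions are angles $\theta\in S^1$ measured from the positive horizontal axis, and at a boundary point $\mathbf{x}$,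 $r(\theta)$ denotes the reflection of $\theta$ through the tangent line at $\mathbf{x}$ (so for a vertical side $r(\theta)=\pi-\theta$). On $(\Omega(B^+)\cup\Omega(B^-))\times S^1$, $(\mathbf{x},\theta)\sim_\pm(\mathbf{y},\gamma)$ if and only if one of the following holds: (i) $\mathbf{x},\mathbf{y}\in\Omega(B^+)^\circ\cup\Omega(B^-)^\circ$ and $(\mathbf{x},\theta)=(\mathbf{y},\gamma)$; (ii) $\mathbf{x},\mathbf{y}\in(B^+\cup B^-)\setminus(A^+\cup A^-)$, $\mathbf{x}=\mathbf{y}$, and $\theta=\gamma$ or $\theta=r(\gamma)$; (iii) $\mathbf{x},\mathbf{y}\in A^+\cup A^-$, and either $\mathbf{x}=\mathbf{y}$ and $\theta=\gamma$, or $\mathbf{x}=\rho(\mathbf{y})$ and $\theta=r(\gamma)+\pi$. A class over a boundary point is represented by a pair $(\mathbf{x},\theta)$ with $\theta$ inward pointing at $\mathbf{x}$. Flow $\Phi_\pm^t$: a point mass moves with unit speed in a straight line in its direction $\theta$ inside $\Omega(B^+)$ or $\Omega(B^-)$. On reaching a point of $B^\pm\setminus(A^+\cup A^-)$ with direction $\theta$ it continues with direction $r(\theta)$ (the law of reflection). On reaching a point $\mathbf{y}\in A^+$ (resp. $A^-$) with direction $\theta$ it continues in the other copy from $\rho(\mathbf{y})$ with direction $r(\theta)+\pi$. The flow is defined as long as the trajectory does not meet a corner. The identity of volume elements means: for the given fixed $t$, the map $\Phi_\pm^t$, written near $((x,y),\theta)$ in the coordinates $(x,y,\theta)\mapsto(x',y',\theta')$,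 pulls the form $dx'\wedge dy'\wedge d\theta'$ back to $-dx\wedge dy\wedge d\theta$. Preservation of the volume element under the flow would mean that the pullback is always $dx\wedge dy\wedge d\theta$.
   Formalization: When A^+ is a proper part of a side, the flow is also left undefined on trajectories meeting an endpoint of A^+ or A^-, where it is discontinuous and the volume identity has no meaning; the English stops the flow only at corners. *)

(* Defs.v *)
From HB Require Import structures.
From mathcomp Require Import all_boot all_order all_algebra.
From mathcomp Require Import all_classical all_reals all_analysis.

Set Implicit Arguments.
Unset Strict Implicit.
Unset Printing Implicit Defensive.
Import Order.TTheory GRing.Theory Num.Theory numFieldNormedType.Exports.
Local Open Scope classical_set_scope.
Local Open Scope ring_scope.

Section Plane.
Variable R : realType.
Implicit Types (z w u d : R * R) (A : set (R * R)).

Definition dot z w : R := z.1 * w.1 + z.2 * w.2.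

Definition cross z w : R := z.1 * w.2 - z.2 * w.1.

(* Reflection of u in the line spanned by d; for d vertical it sends the
   direction of angle th to that of angle pi - th. *)
Definition reflect d u : R * R := (2 * dot u d / dot d d) *: d - u.

Definition vmirror (c : R) z : R * R := (2 * c - z.1, z.2).

(* S^1; the angle th is a local coordinate on it through direction. *)
Definition unit_circle : set (R * R) := [set u | dot u u = 1].

Definition direction (th : R) : R * R := (cos th, sin th).

Definition segment z w : set (R * R) :=
  [set x | exists2 l : R, 0 <= l <= 1 & x = (1 - l) *: z + l *: w].

Definition side n (v : 'I_n -> R * R) (i : 'I_n) : set (R * R) :=
  segment (v i) (v (ordS i)).

Definition polygon n (v : 'I_n -> R * R) : set (R * R) :=
  \bigcup_i side v i.

(* The last conjunct makes every vertex a genuine corner. *)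
Definition simple_polygon n (v : 'I_n -> R * R) : Prop :=
  [/\ (2 < n)%N,
      injective v,
      forall i j, i != j -> side v i `&` side v j
        `<=` [set v i; v (ordS i)] `&` [set v j; v (ordS j)] &
      forall i, cross (v (ordS i) - v i) (v (ordS (ordS i)) - v (ordS i)) != 0].

Definition polygonal_region n (Om : set (R * R)) (v : 'I_n -> R * R) : Prop :=
  [/\ simple_polygon v,
      compact Om /\ closure (interior Om) = Om,
      connected (interior Om) /\ interior Om !=set0 &
      closure Om `\` interior Om = polygon v].

(* A connected subset of a vertical line is an interval of it; having two
   points, it is a segment, with or without either of its endpoints. *)
Definition vertical_segment n (v : 'I_n -> R * R) A : Prop :=
  [/\ A `<=` polygon v,
      connected A,
      exists z w, [/\ A z, A w & z <> w],
      exists a : R, forall z, A z -> z.1 = a &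
      forall i, ~ A (v i)].

End Plane.

Record andreev_billiard (R : realType) := AndreevBilliard {
  table : set (R * R);
  nverts : nat;
  vertex : 'I_nverts -> R * R;
  andreev : set (R * R);
  axis : R;
  table_polygonal : polygonal_region table vertex;
  andreev_vertical : vertical_segment vertex andreev;
  axis_outside : forall z, interior table z -> z.1 <> axis }.

Arguments table {R} _ _.
Arguments nverts {R} _.
Arguments vertex {R} _ _.
Arguments andreev {R} _ _.
Arguments axis {R} _.

(* sheet = true for the copy B^+, false for B^-; dir ranges over S^1. *)
Record state (R : realType) := State {
  sheet : bool;
  pos : R * R;
  dir : R * R }.

Section Billiard.
Variables (R : realType) (D : andreev_billiard R).
Implicit Types (s : bool) (z u : R * R) (t : R) (p q : state R).

Definition rho z : R * R := vmirror (axis D) z.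

Definition to_sheet s z : R * R := if s then z else rho z.

Definition Omega s : set (R * R) := to_sheet s @` table D.

Definition vert s (i : 'I_(nverts D)) : R * R := to_sheet s (vertex D i).

Definition bnd s : set (R * R) := polygon (vert s).

Definition Aset s : set (R * R) := to_sheet s @` andreev D.

Definition corner s : set (R * R) := range (vert s).

(* The corners, and the endpoints of the Andreev segment, where the two
   boundary laws disagree on arbitrarily near points.  When the segment is a
   whole open side of the polygon these endpoints are corners. *)
Definition singular s : set (R * R) :=
  corner s `|` (closure (Aset s) `&` closure (bnd s `\` Aset s)).

(* u' = r(u) at the boundary point z; the tangent line, hence r, does not
   exist at a corner. *)
Definition reflected s z u u' : Prop :=
  ~ corner s z /\
  exists2 i, side (vert s) i z & u' = reflect (vert s (ordS i) - vert s i) u.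

Definition states : set (state R) :=
  [set p | Omega (sheet p) (pos p) /\ unit_circle (dir p)].

(* The relation ~_pm.  The two sheets are distinct copies, so that equality of
   points includes equality of sheets; theta + pi is the opposite vector.  Over
   a corner no two distinct directions are identified. *)
Definition glued p q : Prop :=
  [\/ [/\ interior (Omega (sheet p)) (pos p),
          interior (Omega (sheet q)) (pos q) & p = q],
      [/\ (bnd (sheet p) `\` Aset (sheet p)) (pos p),
          (bnd (sheet q) `\` Aset (sheet q)) (pos q),
          sheet p = sheet q, pos p = pos q &
          dir p = dir q \/ reflected (sheet q) (pos q) (dir q) (dir p)] |
      [/\ Aset (sheet p) (pos p), Aset (sheet q) (pos q) &
          p = q \/
          [/\ sheet p = ~~ sheet q, pos p = rho (pos q) &
              exists2 u, reflected (sheet q) (pos q) (dir q) u &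
                dir p = - u]]].

Definition pclass p : set (state R) := [set q | states q /\ glued p q].

Definition phase_space : set (set (state R)) := pclass @` states.

Definition free_motion s z u t : Prop :=
  [/\ forall l, 0 < l < t -> interior (Omega s) (z + l *: u),
      ~ singular s z & ~ singular s (z + t *: u)].

Inductive orbit p : R -> state R -> Prop :=
| orbit_free t : 0 <= t -> free_motion (sheet p) (pos p) (dir p) t ->
    orbit p t (State (sheet p) (pos p + t *: dir p) (dir p))
| orbit_reflect t t' s z u u' : orbit p t (State s z u) ->
    (bnd s `\` Aset s) z -> reflected s z u u' ->
    0 < t' -> free_motion s z u' t' ->
    orbit p (t + t') (State s (z + t' *: u') u')
| orbit_andreev t t' s z u u' : orbit p t (State s z u) ->
    Aset s z -> reflected s z u u' ->
    0 < t' -> free_motion (~~ s) (rho z) (- u') t' ->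
    orbit p (t + t') (State (~~ s) (rho z + t' *: (- u')) (- u')).

(* Phi^t is defined at the point P of the phase space, with value Q; the
   representative p of P that moves is the inward pointing one. *)
Definition flow t (P Q : set (state R)) : Prop :=
  [/\ phase_space P, phase_space Q &
      exists p q, [/\ P p, Q q & orbit p t q]].

End Billiard.

Section VolumeForm.
Variable R : realType.
Implicit Types (q : 'rV[R]_3) (F : 'rV[R]_3 -> 'rV[R]_3).

Definition form3 := ('I_3 -> 'rV[R]_3) -> R.

Definition vol : form3 := fun w => \det (\matrix_(i < 3) w i).

Definition pullback F q (om : form3) : form3 := fun w => om (fun i => 'd F q (w i)).

Definition xy q : R * R := (q 0 0, q 0 1).

Definition angle q : R := q 0 2.

Variable D : andreev_billiard R.

(* The point of the phase space with coordinates q = (x, y, th) on sheet s. *)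
Definition at_coord (s : bool) q : set (state R) :=
  pclass D (State s (xy q) (direction (angle q))).

(* F is the map Phi^t written in coordinates near q, with values near q'; as a
   map into R^3 it involves a choice of angle modulo 2 pi, fixed at q by q'. *)
Definition coord_expr (t : R) s q s' q' F : Prop :=
  [/\ F q = q', differentiable F q &
      \forall x \near q, flow D t (at_coord s x) (at_coord s' (F x))].

Definition volume_preserved : Prop :=
  forall (t : R) s q s' q' F, 0 < t ->
    interior (Omega D s) (xy q) -> interior (Omega D s') (xy q') ->
    coord_expr t s q s' q' F -> forall w, pullback F q vol w = vol w.

End VolumeForm.

(* Main.v *)
(* A trajectory is followed through the straight line it runs on after each
   bounce, recorded by the position (x, y) which that motion would have had at
   time 0 and by its direction theta.  A side acts on such lines by an affine
   reflection of (x, y) together with theta |-> psi - theta, of Jacobian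
   (-1)(-1) = 1.  The Andreev segment x = a acts by
   (x, y, theta) |-> (x + k, y + 2 (a - x) tan theta, - theta), of Jacobian -1.
   The time-t map is a composition of these maps followed by the shear
   (x, y, theta) |-> (x + t cos theta, y + t sin theta, theta), so that its
   Jacobian is -1 to the number of crossings, which is odd between the sheets.

   This composition describes the flow at every point near q because the orbit
   of q meets the sides transversally and away from the singular points, and
   because, near a point of a side which is not a corner, the table is a
   half-disk.  The flow being deterministic, every coordinate expression of it
   agrees with this composition near q up to a constant angle.  A trajectory
   perpendicular to the Andreev segment shows that crossings occur. *)
Require Import Defs.
From HB Require Import structures.
From mathcomp Require Import all_boot all_order all_algebra.
From mathcomp Require Import all_classical all_reals all_analysis.
From mathcomp Require Import ring lra.
Import Order.TTheory GRing.Theory Num.Theory numFieldNormedType.Exports.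
Set Implicit Arguments.
Unset Strict Implicit.
Unset Printing Implicit Defensive.
Local Open Scope classical_set_scope.
Local Open Scope ring_scope.

(** * Plane geometry *)

Section Convergence.
Variables (R : realType) (I : Type) (F : set_system I).
Context {FF : Filter F}.
Implicit Types (f g : I -> R * R) (a b : R * R).

Lemma cvg_proj1 f a : f @ F --> a -> (f i).1 @[i --> F] --> a.1.
Proof. by move=> fa; apply: (cvg_comp f fst fa); exact: cvg_fst. Qed.

Lemma cvg_proj2 f a : f @ F --> a -> (f i).2 @[i --> F] --> a.2.
Proof. by move=> fa; apply: (cvg_comp f snd fa); exact: cvg_snd. Qed.

Lemma cvg_prod2 (f1 f2 : I -> R) a :
  f1 @ F --> a.1 -> f2 @ F --> a.2 -> (f1 i, f2 i) @[i --> F] --> a.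
Proof. by case: a => a1 a2 h1 h2; exact: cvg_pair h1 h2. Qed.

Lemma cvg_cross f g a b : f @ F --> a -> g @ F --> b ->
  cross (f i) (g i) @[i --> F] --> cross a b.
Proof.
move=> fa gb; apply: cvgB; apply: cvgM;
  by [apply: cvg_proj1|apply: cvg_proj2].
Qed.

Lemma cvg_dot f g a b : f @ F --> a -> g @ F --> b ->
  dot (f i) (g i) @[i --> F] --> dot a b.
Proof.
move=> fa gb; apply: cvgD; apply: cvgM;
  by [apply: cvg_proj1|apply: cvg_proj2].
Qed.

End Convergence.

Section Plane.
Variable R : realType.
Implicit Types (z w u d : R * R) (A : set (R * R)).

Lemma eq_coord z w : z.1 = w.1 -> z.2 = w.2 -> z = w.
Proof. by case: z w => ? ? [? ?] /= -> ->. Qed.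

Lemma fstD z w : (z + w).1 = z.1 + w.1. Proof. by []. Qed.
Lemma sndD z w : (z + w).2 = z.2 + w.2. Proof. by []. Qed.
Lemma fstN z : (- z).1 = - z.1. Proof. by []. Qed.
Lemma sndN z : (- z).2 = - z.2. Proof. by []. Qed.
Lemma fstZ (l : R) z : (l *: z).1 = l * z.1. Proof. by []. Qed.
Lemma sndZ (l : R) z : (l *: z).2 = l * z.2. Proof. by []. Qed.
Definition coordE := (fstD, sndD, fstN, sndN, fstZ, sndZ).

Lemma dot_gt0 d : d != 0 -> 0 < dot d d.
Proof.
move=> d0; rewrite lt_neqAle addr_ge0 ?sqr_ge0 ?andbT -?expr2 ?sqr_ge0 //.
apply: contra d0; rewrite eq_sym /dot -!expr2 paddr_eq0 ?sqr_ge0 // !sqrf_eq0.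
by case/andP=> /eqP h1 /eqP h2; apply/eqP/eq_coord.
Qed.

Lemma cross_eq0 d w : d != 0 -> cross d w = 0 -> w = (dot w d / dot d d) *: d.
Proof.
move=> /dot_gt0 /lt0r_neq0 dd0 cdw; rewrite /cross in cdw.
(* Both identities are the coordinates of |d|^2 w = (w . d) d + (d x w) d', where d' = (- d.2, d.1)
   is d turned by a right angle. *)
have e1 : w.1 * dot d d = dot w d * d.1 + (- d.2) * (d.1 * w.2 - d.2 * w.1).
  by rewrite /dot; ring.
have e2 : w.2 * dot d d = dot w d * d.2 + d.1 * (d.1 * w.2 - d.2 * w.1).
  by rewrite /dot; ring.
rewrite cdw mulr0 addr0 in e1; rewrite cdw mulr0 addr0 in e2.
by apply: eq_coord; rewrite !coordE mulrAC -?e1 -?e2 mulfK.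
Qed.

Lemma segmentP z w x : segment z w x <->
  exists2 l : R, 0 <= l <= 1 & x = z + l *: (w - z).
Proof.
by split=> -[l l01 ->]; exists l => //; apply: eq_coord; rewrite !coordE; ring.
Qed.

Lemma segment_continuous z w : continuous (fun l : R => z + l *: (w - z)).
Proof. by move=> l; apply: cvgD; [exact: cvg_cst|exact: cvgZl]. Qed.

Lemma segment_image z w :
  segment z w = (fun l : R => z + l *: (w - z)) @` `[0, 1].
Proof.
apply/seteqP; split=> x.
  by move=> /segmentP[l l01 ->]; exists l => //=; rewrite in_itv.
by move=> [l /= + <-]; rewrite in_itv => l01; apply/segmentP; exists l.
Qed.

Lemma segment_closed z w : closed (segment z w).
Proof.
apply: compact_closed; first exact: norm_hausdorff.
rewrite segment_image; apply: continuous_compact.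
  exact/continuous_subspaceT/segment_continuous.
exact: segment_compact.
Qed.

Lemma segment_is_connected z w : connected (segment z w).
Proof.
rewrite segment_image; apply: connected_continuous_connected.
  exact: segment_connected.
exact/continuous_subspaceT/segment_continuous.
Qed.

(* Off the frontier of the closed set Om, interior Om and Om coincide, so that
   interior Om is clopen in A. *)
Lemma connected_interior Om A z : closed Om -> connected A ->
  (forall y, A y -> ~ (Om `\` interior Om) y) ->
  A z -> interior Om z -> A `<=` interior Om.
Proof.
move=> clOm cA AOm Az Omz.
have : A `&` interior Om = A.
  apply: cA; first by exists z.
    by exists (interior Om) => //; exact: open_interior.
  exists Om => //; apply/seteqP; split=> y [Ay Omy]; split=> //.
    exact: interior_subset.
  by apply: contrapT => nOmy; apply: (AOm y).
by move=> <- y [].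
Qed.

Definition convex_set A :=
  forall z w, A z -> A w -> segment z w `<=` A.

Lemma ball_convex z (r : R) : convex_set (ball z r).
Proof.
move=> w w' [h1 h2] [h1' h2'] x [l /andP[l0 l1] ->].
rewrite /ball/= in h1 h2 h1' h2' *.
(* A ball of the product is a square, so convexity is checked on each coordinate. *)
have aux (a b c : R) : `|a - b| < r -> `|a - c| < r ->
    `|a - ((1 - l) * b + l * c)| < r.
  have [->|ln0] := eqVneq l 0; first by rewrite subr0 mul1r mul0r addr0.
  have lp : 0 < l by rewrite lt_neqAle eq_sym ln0.
  rewrite !ltr_distlC => /andP[? ?] /andP[? ?]; apply/andP; split; nra.
by split; apply: aux.
Qed.

Lemma small_step (O : set (R * R)) z w (d : R) : 0 < d -> nbhs z O ->
  exists2 k : R, 0 < k < d & O (z + k *: w).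
Proof.
move=> d0 zO.
have cv : z + k *: w @[k --> (0 : R)] --> z + 0 *: w.
  by apply: cvgD; [exact: cvg_cst|apply: cvgZl; exact: cvg_id].
rewrite scale0r addr0 in cv.
have /nbhs_ballP[r /= r0 rO] := cv _ zO.
exists (Num.min r d / 2).
  by rewrite divr_gt0 ?lt_min ?r0 //= ltr_pdivrMr // mulr_natr mulr2n
    gt_min ltrDl d0 orbT.
apply: (rO (Num.min r d / 2)); rewrite /ball /= sub0r normrN gtr0_norm.
  by rewrite ltr_pdivrMr // mulr_natr mulr2n gt_min ltrDl r0.
by rewrite divr_gt0 ?lt_min ?r0.
Qed.

End Plane.

(** * Local structure of a simple polygon and of its region *)

Section Polygon.
Variables (R : realType) (n : nat) (v : 'I_n -> R * R).
Hypothesis spv : simple_polygon v.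
Implicit Types (y z : R * R) (i j : 'I_n).

Definition edge i : R * R := v (ordS i) - v i.

Lemma edge_neq0 i : edge i != 0.
Proof.
have [_ _ _ /(_ i)] := spv; apply: contra => /eqP; rewrite /edge => ->.
by rewrite /cross !mul0r subrr.
Qed.

Lemma side_closed i : closed (side v i).
Proof. exact: segment_closed. Qed.

Lemma polygon_closed : closed (polygon v).
Proof.
apply: closed_bigcup => [|i _]; [exact: finite_finset|exact: side_closed].
Qed.

Lemma range_closed : closed (range v).
Proof.
have /accessible_finite_set_closed : accessible_space (R * R)%type.
  exact/hausdorff_accessible/norm_hausdorff.
by apply; apply: finite_image; exact: finite_finset.
Qed.

Lemma range_polygon : range v `<=` polygon v.
Proof.
move=> _ [i _ <-]; exists i => //; exists 0; first by rewrite lexx ler01.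
by rewrite subr0 scale1r scale0r addr0.
Qed.

Lemma side_inj i j z : side v i z -> side v j z -> ~ range v z -> i = j.
Proof.
move=> iz jz nz; apply: contrapT => /eqP ij.
have [_ _ /(_ _ _ ij) h _] := spv.
by have [[] zE _] := h _ (conj iz jz); apply: nz; rewrite zE;
  [exists i|exists (ordS i)].
Qed.

Lemma sideE i z : side v i z -> ~ range v z ->
  exists2 l : R, 0 < l < 1 & z = v i + l *: edge i.
Proof.
move=> /segmentP[l /andP[l0 l1] ->] nz; exists l => //.
rewrite !lt_neqAle l0 l1 !andbT; apply/andP; split; apply/eqP => le; apply: nz.
  by exists i => //; rewrite -le scale0r addr0.
by exists (ordS i) => //; rewrite le scale1r addrC subrK.
Qed.

(** The other sides and the vertices form closed sets that miss z. Near z only side i remains, and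
    it cannot be told apart from the full line that carries it. *)
Lemma near_side i z : side v i z -> ~ range v z ->
  \forall y \near z, [/\ (polygon v y <-> cross (edge i) (y - v i) = 0),
    (polygon v y -> side v i y) & ~ range v y].
Proof.
move=> iz nz; have [l /andP[l0 l1] zE] := sideE iz nz.
pose others := \bigcup_(j in [set j | j != i]) side v j.
have cothers : closed others.
  apply: closed_bigcup => [|j _]; [exact: finite_finset|exact: side_closed].
have nothers : ~ others z.
  by move=> [j /= /eqP ji jz]; apply: ji; apply: side_inj jz iz nz.
have no : \forall y \near z, (~` others) y.
  by apply: open_nbhs_nbhs; split => //; exact: closed_openC.
have nr : \forall y \near z, (~` range v) y.
  by apply: open_nbhs_nbhs; split => //; exact/closed_openC/range_closed.
have dd := dot_gt0 (edge_neq0 i).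
(* The parameter of the orthogonal projection of y on the line of side i. It tends to l, so it stays
   in ]0, 1[, which puts nearby points of that line on the side itself. *)
pose m y := dot (y - v i) (edge i) / dot (edge i) (edge i).
have mz : m y @[y --> z] --> l.
  have -> : l = m z.
    rewrite /m zE addrAC subrr add0r.
    have -> : dot (l *: edge i) (edge i) = l * dot (edge i) (edge i).
      by rewrite /dot !coordE; ring.
    by rewrite mulfK // gt_eqF.
  apply: cvgM; last exact: cvg_cst.
  apply: cvg_dot; last exact: cvg_cst.
  by apply: cvgB; [exact: cvg_id|exact: cvg_cst].
near=> y.
have noy : ~ others y by near: y; exact: no.
have nry : ~ range v y by near: y; exact: nr.
have m0 : 0 < m y by near: y; exact: (cvgr_gt _ mz).
have m1 : m y < 1 by near: y; exact: (cvgr_lt _ mz).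
have sy : polygon v y -> side v i y.
  move=> [j _ jy]; have [<-//|ji] := eqVneq j i.
  by case: noy; exists j.
split=> //; split.
  move=> /sy /segmentP[k _ ->].
  by rewrite /cross /edge !coordE; ring.
move=> /(cross_eq0 (edge_neq0 i)); rewrite -/(m y) => yE.
exists i => //; apply/segmentP; exists (m y); first by rewrite !ltW.
by rewrite -[_ *: _]yE addrC subrK.
Unshelve. all: by end_near. Qed.

Variable Om : set (R * R).
Hypothesis clOm : closed Om.
Hypothesis bdOm : Om `\` interior Om = polygon v.

Lemma interior_polygon z : interior Om z -> ~ polygon v z.
Proof. by rewrite -bdOm => ? []. Qed.

(** The segment from [y0] to [y1] stays in the ball and strictly on one side of the line of side i.
    Hence it misses the polygon, and by connectedness it cannot leave the interior. *)
Lemma near_half_disk i z : side v i z -> ~ range v z ->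
  exists2 r : R, 0 < r & forall y0 y1, ball z r y0 -> ball z r y1 ->
    interior Om y0 ->
    0 < cross (edge i) (y0 - v i) * cross (edge i) (y1 - v i) ->
    interior Om y1.
Proof.
move=> iz nz; have /nbhs_ballP[r /= r0 near_r] := near_side iz nz.
exists r => // y0 y1 y0r y1r Omy0 c01.
apply: (connected_interior clOm (@segment_is_connected _ y0 y1) _ _ Omy0).
- move=> y ys; rewrite bdOm => pvy.
  have [[/(_ pvy) cy _] _ _] := near_r _ (ball_convex y0r y1r ys).
  have [k /andP[k0 k1] yE] := ys; move: cy.
  set c0 := cross _ (y0 - _) in c01; set c1 := cross _ (y1 - _) in c01.
  have -> : cross (edge i) (y - v i) = (1 - k) * c0 + k * c1.
    by rewrite yE /c0 /c1 /cross !coordE; ring.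
  move=> c; have [k00|kn0] := eqVneq k 0.
    by move: c c01; rewrite k00 subr0 mul1r mul0r addr0 => ->;
      rewrite mul0r ltxx.
  have kc : 0 < k * (c0 * c1) by rewrite mulr_gt0 // lt_neqAle eq_sym kn0.
  have kc' : 0 <= (1 - k) * (c0 * c0) by rewrite mulr_ge0 ?subr_ge0 // -expr2
    sqr_ge0.
  have : ((1 - k) * c0 + k * c1) * c0 = 0 by rewrite c mul0r.
  by move=> ?; lra.
- by exists 0; rewrite ?lexx ?ler01 // subr0 scale1r scale0r addr0.
- by exists 1; rewrite ?lexx ?ler01 // subrr scale1r scale0r add0r.
Qed.

End Polygon.

(** * The two sheets *)

Section Sheets.
Variables (R : realType) (D : andreev_billiard R).
Implicit Types (s : bool) (z w u : R * R).

Lemma rhoK : involutive (rho D).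
Proof. by move=> z; apply: eq_coord => //=; ring. Qed.

Lemma to_sheetK s : involutive (to_sheet D s).
Proof. by case: s => //; exact: rhoK. Qed.

Lemma to_sheet_rho s z : to_sheet D (~~ s) (rho D z) = to_sheet D s z.
Proof. by case: s => //=; rewrite rhoK. Qed.

Lemma to_sheet_continuous s : continuous (to_sheet D s).
Proof.
case: s => z; first exact: cvg_id.
apply: cvg_prod2 => /=; last by apply: cvg_proj2; exact: cvg_id.
by apply: cvgB; [exact: cvg_cst|apply: cvg_proj1; exact: cvg_id].
Qed.

(** As [to_sheet s] is an involution, images under it are preimages. Facts on either sheet thus
    reduce to facts on the original table. *)
Lemma to_sheet_image s (A : set (R * R)) :
  to_sheet D s @` A = to_sheet D s @^-1` A.
Proof.
apply/seteqP; split=> z; first by move=> [y Ay <-] /=; rewrite to_sheetK.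
by move=> Az; exists (to_sheet D s z) => //; rewrite to_sheetK.
Qed.

Lemma nbhs_to_sheet s z (A : set (R * R)) :
  nbhs z (to_sheet D s @^-1` A) <-> nbhs (to_sheet D s z) A.
Proof.
split=> [|zA]; last exact: (to_sheet_continuous zA).
rewrite -{1}[z](to_sheetK s) => /to_sheet_continuous zA.
rewrite (_ : A = to_sheet D s @^-1` (to_sheet D s @^-1` A)) //.
by apply/seteqP; split=> y /=; rewrite to_sheetK.
Qed.

Lemma interior_Omega s z :
  interior (Omega D s) z <-> interior (table D) (to_sheet D s z).
Proof. by rewrite /Omega to_sheet_image; exact: nbhs_to_sheet. Qed.

Lemma to_sheet_segment s z w x :
  segment (to_sheet D s z) (to_sheet D s w) x <->
  segment z w (to_sheet D s x).
Proof.
suff aux z' w' x' : segment z' w' x' ->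
    segment (to_sheet D s z') (to_sheet D s w') (to_sheet D s x').
  by split=> /aux; rewrite !to_sheetK.
case: s {z w x} => // -[l l01 ->]; exists l => //=.
by apply: eq_coord; rewrite /= /GRing.scale /=; ring.
Qed.

Lemma side_vert s i z : side (@vert R D s) i z <-> side (vertex D) i (to_sheet
  D s z).
Proof. exact: to_sheet_segment. Qed.

Lemma bndE s z : bnd D s z <-> polygon (vertex D) (to_sheet D s z).
Proof. by split=> -[i _ /side_vert iz]; exists i. Qed.

Lemma AsetE s z : Aset D s z <-> andreev D (to_sheet D s z).
Proof. by rewrite /Aset to_sheet_image. Qed.

Lemma cornerE s z : corner D s z <-> range (vertex D) (to_sheet D s z).
Proof.
split=> [[i _ <-]|[i _ e]]; exists i => //; first by rewrite /vert to_sheetK.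
by rewrite /vert e to_sheetK.
Qed.

Lemma Omega_closed s : closed (Omega D s).
Proof.
have [_ [/(compact_closed (@norm_hausdorff _ _)) cl _] _ _] :=
  table_polygonal D.
rewrite /Omega to_sheet_image; apply: closed_comp => //.
by move=> z _; exact: to_sheet_continuous.
Qed.

Lemma Omega_bnd s : Omega D s `\` interior (Omega D s) = bnd D s.
Proof.
have [_ [/(compact_closed (@norm_hausdorff _ _)) cl _] _] :=
  table_polygonal D.
rewrite closure_id in cl; rewrite -cl => bd.
apply/seteqP; split=> z.
  rewrite /Omega to_sheet_image => -[Oz nOz]; apply/bndE; rewrite -bd;
    split=> //.
  by move=> Ti; apply: nOz; apply/nbhs_to_sheet.
move=> /bndE; rewrite -bd => -[Oz nOz]; split;
  first by rewrite /Omega to_sheet_image.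
by move=> /interior_Omega.
Qed.

Lemma vert_simple s : simple_polygon (@vert R D s).
Proof.
have [sp _ _ _] := table_polygonal D.
case: s; first exact: sp.
have [n2 vi disj cr] := sp; split=> //.
- by move=> i j /(can_inj rhoK) /vi.
- move=> i j /disj h z [/side_vert zi /side_vert zj].
  have [zi' zj'] := h _ (conj zi zj).
  by split; [case: zi' => e|case: zj' => e]; [left|right|left|right];
    apply: (can_inj (to_sheetK false)); rewrite e /vert to_sheetK.
(* A mirror changes [cross] by a sign only, so corners stay genuine. *)
- move=> i; have := cr i; apply: contra => /eqP h; apply/eqP.
  rewrite -[RHS]oppr0 -[X in _ = - X]h /cross /= ; ring.
Qed.

Lemma bnd_closed s : closed (bnd D s).
Proof. exact: polygon_closed. Qed.

Lemma Aset_bnd s : Aset D s `<=` bnd D s.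
Proof.
by have [h _ _ _ _] := andreev_vertical D; move=> z /AsetE /h /bndE.
Qed.

Lemma interior_bnd s z : interior (Omega D s) z -> ~ bnd D s z.
Proof. by rewrite -Omega_bnd => ? []. Qed.

Lemma singular_bnd s : singular D s `<=` bnd D s.
Proof.
move=> z [/range_polygon //|[+ _]].
have /closure_id -> := @bnd_closed s.
by apply: closure_subset; exact: Aset_bnd.
Qed.

Lemma interior_nonsingular s z : interior (Omega D s) z -> ~ singular D s z.
Proof. by move=> /interior_bnd + /singular_bnd. Qed.

Lemma singular_closed s : closed (singular D s).
Proof.
apply: closedU; first exact: range_closed.
by apply: closedI; exact: closed_closure.
Qed.

Lemma near_nonsingular s z : ~ singular D s z ->
  \forall y \near z, ~ singular D s y.
Proof.
move=> nz; apply: open_nbhs_nbhs; split=> //;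
  exact/closed_openC/singular_closed.
Qed.

(** The closure clause of [singular] serves here: a nonsingular point of the Andreev segment is not
    a limit of boundary points outside it. The next lemma is the dual case. *)
Lemma near_Aset s z : Aset D s z -> ~ singular D s z ->
  \forall y \near z, bnd D s y -> Aset D s y.
Proof.
move=> Az nz; have : ~ closure (bnd D s `\` Aset D s) z.
  by move=> cz; apply: nz; right; split=> //; exact: subset_closure.
move=> nc; have : \forall y \near z, ~ closure (bnd D s `\` Aset D s) y.
  by apply: open_nbhs_nbhs; split=> //; exact/closed_openC/closed_closure.
apply: filterS => y ny By; apply: contrapT => nAy; apply: ny.
exact: subset_closure.
Qed.

Lemma near_bndD s z : (bnd D s `\` Aset D s) z -> ~ singular D s z ->
  \forall y \near z, bnd D s y -> (bnd D s `\` Aset D s) y.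
Proof.
move=> Az nz; have : ~ closure (Aset D s) z.
  by move=> cz; apply: nz; right; split=> //; exact: subset_closure.
move=> nc; have : \forall y \near z, ~ closure (Aset D s) y.
  by apply: open_nbhs_nbhs; split=> //; exact/closed_openC/closed_closure.
apply: filterS => y ny By; split=> // Ay; apply: ny; exact: subset_closure.
Qed.

Lemma Aset_abscissa s : exists a : R, forall z, Aset D s z -> z.1 = a.
Proof.
have [_ _ _ [a Aa] _] := andreev_vertical D.
case: s; first by exists a => z /AsetE /Aa.
by exists (2 * axis D - a) => z /AsetE /Aa /= <-; ring.
Qed.

Lemma reflected_inj s z u u1 u2 :
  reflected D s z u u1 -> reflected D s z u u2 -> u1 = u2.
Proof.
move=> [nz [i iz ->]] [_ [j jz ->]].
by rewrite (side_inj (@vert_simple s) iz jz nz).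
Qed.

(** The two gluing clauses that identify distinct states concern boundary points only, so a class
    over an interior point is a singleton. *)
Lemma pclass_interior s z u p : interior (Omega D s) z ->
  pclass D (State s z u) p -> p = State s z u.
Proof.
move=> Oz [_ [[_ _ ->//]|[]|[]]] /=; first by move=> [/(interior_bnd Oz)].
by move=> /Aset_bnd /(interior_bnd Oz).
Qed.

Lemma pclass_refl s z u : interior (Omega D s) z -> dot u u = 1 ->
  pclass D (State s z u) (State s z u).
Proof.
move=> Oz u1; split; last by apply: Or31.
by split=> //=; exact: interior_subset.
Qed.

Lemma phase_space_interior s z u : interior (Omega D s) z -> dot u u = 1 ->
  phase_space D (pclass D (State s z u)).
Proof.
by move=> Oz u1; exists (State s z u) => //; split=> //=;
  exact: interior_subset.
Qed.

End Sheets.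

(** * Determinism of the flow *)

Section Determinism.
Variables (R : realType) (D : andreev_billiard R).
Implicit Types (p b r : state R).

Definition open_leg s (z u : R * R) (t : R) :=
  forall l, 0 < l < t -> interior (Omega D s) (z + l *: u).

(* leg p n T b: the orbit of p bounces for the n-th time at time T and leaves in
   the state b. *)
Inductive leg p : nat -> R -> state R -> Prop :=
| leg_start : leg p 0 0 p
| leg_reflect n T s z u h u' : leg p n T (State s z u) ->
    0 < h -> open_leg s z u h -> (bnd D s `\` Aset D s) (z + h *: u) ->
    reflected D s (z + h *: u) u u' ->
    leg p n.+1 (T + h) (State s (z + h *: u) u')
| leg_andreev n T s z u h u' : leg p n T (State s z u) ->
    0 < h -> open_leg s z u h -> Aset D s (z + h *: u) ->
    reflected D s (z + h *: u) u u' ->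
    leg p n.+1 (T + h) (State (~~ s) (rho D (z + h *: u)) (- u')).

Lemma open_leg_hit s z u h h' : open_leg s z u h' -> 0 < h ->
  bnd D s (z + h *: u) -> h' <= h.
Proof.
move=> opn h0 hb; rewrite leNgt; apply/negP => hh'.
by apply: interior_bnd hb; apply: opn; rewrite h0.
Qed.

(** Induction on the number of bounces: the next one occurs at the first return to the boundary,
    there the two laws exclude each other, and off the corners the reflected direction is unique. *)
Lemma leg_inj n p T b T' b' : leg p n T b -> leg p n T' b' ->
  T = T' /\ b = b'.
Proof.
elim: n T b T' b' => [|n IH] T b T' b' l1 l2.
  by inversion l1; inversion l2; subst.
inversion l1 as [|? T1 s1 z1 u1 h1 w1 L1 p1 o1 B1 f1|
  ? T1 s1 z1 u1 h1 w1 L1 p1 o1 B1 f1]; subst; clear l1;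
inversion l2 as [|? T2 s2 z2 u2 h2 w2 L2 p2 o2 B2 f2|
  ? T2 s2 z2 u2 h2 w2 L2 p2 o2 B2 f2]; subst; clear l2;
have [eT [es ez eu]] := IH _ _ _ _ L1 L2; subst.
- have eh : h1 = h2.
    by apply/eqP; rewrite eq_le (open_leg_hit o1 p2 B2.1) (open_leg_hit o2 p1
      B1.1).
  by subst; rewrite (reflected_inj f1 f2).
- have eh : h1 = h2.
    apply/eqP; rewrite eq_le (open_leg_hit o1 p2 (Aset_bnd B2)).
    by rewrite (open_leg_hit o2 p1 B1.1).
  by subst; case: B1.
- have eh : h1 = h2.
    apply/eqP; rewrite eq_le (open_leg_hit o1 p2 B2.1).
    by rewrite (open_leg_hit o2 p1 (Aset_bnd B1)).
  by subst; case: B2.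
- have eh : h1 = h2.
    apply/eqP; rewrite eq_le (open_leg_hit o1 p2 (Aset_bnd B2)).
    by rewrite (open_leg_hit o2 p1 (Aset_bnd B1)).
  by subst; rewrite (reflected_inj f1 f2).
Qed.

Lemma leg_next n m p T b T' b' : leg p n T b -> leg p m T' b' -> (n < m)%N ->
  exists h, [/\ 0 < h, bnd D (sheet b) (pos b + h *: dir b) & T + h <= T'].
Proof.
move=> l1 l2; elim: l2 => {m T' b'} [//|m T' s z u h u' l2 IH h0 _ B _|
    m T' s z u h u' l2 IH h0 _ /Aset_bnd B _]; rewrite ltnS leq_eqVlt.
- case/orP=> [/eqP e|/IH [k [k0 Bk le]]].
    subst; have [-> ->] := leg_inj l1 l2; exists h => /=; split=> //;
      exact: B.1.
  by exists k; split=> //; rewrite (le_trans le) // lerDl ltW.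
- case/orP=> [/eqP e|/IH [k [k0 Bk le]]].
    by subst; have [-> ->] := leg_inj l1 l2; exists h.
  by exists k; split=> //; rewrite (le_trans le) // lerDl ltW.
Qed.

(** Normal form of an orbit: n bounces, then a last free leg. This leg has positive length as soon
    as n > 0, so every counted bounce occurs strictly before t. *)
Lemma orbit_leg p t r : interior (Omega D (sheet p)) (pos p) ->
  Defs.orbit D p t r -> exists n T b h,
  [/\ leg p n T b, t = T + h, (0 <= h /\ ((0 < n)%N -> 0 < h)),
      open_leg (sheet b) (pos b) (dir b) h &
      r = State (sheet b) (pos b + h *: dir b) (dir b)].
Proof.
move=> Op; elim=> {t r} [t t0 [opn _ _]|t t' s z u u' _ IH|t t' s z u u' _ IH].
- by exists 0%N, 0, p, t; split; rewrite ?add0r //; exact: leg_start.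
- case: IH => n [T [[s0 z0 u0] [h [lg -> [h0 hn] opn [-> -> ->]]]]] /=.
  move=> B f t'0 [opn' _ _].
  (* Were h = 0, no bounce would have occurred yet, and the boundary point reached would be the
     interior starting point. *)
  have hp : 0 < h.
    rewrite lt_neqAle h0 andbT; apply/eqP => he; subst h.
    inversion lg; subst; last 2 first.
    + by have := hn isT; rewrite ltxx.
    + by have := hn isT; rewrite ltxx.
    by move: B.1; rewrite scale0r addr0; apply: interior_bnd.
  exists n.+1, (T + h), (State s0 (z0 + h *: u0) u'), t'; split=> //=.
    exact: leg_reflect.
  by split=> //; exact: ltW.
- case: IH => n [T [[s0 z0 u0] [h [lg -> [h0 hn] opn [-> -> ->]]]]] /=.
  move=> B f t'0 [opn' _ _].
  have hp : 0 < h.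
    rewrite lt_neqAle h0 andbT; apply/eqP => he; subst h.
    inversion lg; subst; last 2 first.
    + by have := hn isT; rewrite ltxx.
    + by have := hn isT; rewrite ltxx.
    by move: (Aset_bnd B); rewrite scale0r addr0; apply: interior_bnd.
  exists n.+1, (T + h), (State (~~ s0) (rho D (z0 + h *: u0)) (- u')), t'.
  split=> //=; last by split=> //; exact: ltW.
  exact: leg_andreev.
Qed.

(** If the numbers of bounces differed, the orbit with fewer would meet the boundary strictly before
    t, inside its last free leg. With equal numbers the bounces agree, hence also the last legs. *)
Lemma orbit_inj p t r r' : interior (Omega D (sheet p)) (pos p) ->
  Defs.orbit D p t r -> Defs.orbit D p t r' -> r = r'.
Proof.
move=> Op /(orbit_leg Op) [n [T [b [h [lg tE [h0 hn] opn ->]]]]].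
move=> /(orbit_leg Op) [n' [T' [b' [h' [lg' tE' [h0' hn'] opn' ->]]]]].
case: (ltngtP n n') => nn'.
- have [k [k0 Bk le]] := leg_next lg lg' nn'.
  have := open_leg_hit opn k0 Bk.
  have := hn' (leq_ltn_trans (leq0n _) nn').
  by move=> ? ?; exfalso; lra.
- have [k [k0 Bk le]] := leg_next lg' lg nn'.
  have := open_leg_hit opn' k0 Bk.
  have := hn (leq_ltn_trans (leq0n _) nn').
  by move=> ? ?; exfalso; lra.
- subst n'; have [eT ->] := leg_inj lg lg'.
  by have -> : h = h' by lra.
Qed.

End Determinism.

(** * Maps scaling the volume form *)

Section VolumeFactor.
Variable R : realType.
Implicit Types (q w : 'rV[R]_3) (F E : 'rV[R]_3 -> 'rV[R]_3) (e : R).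

Definition vec3 (a b c : R) : 'rV[R]_3 := \row_j [:: a; b; c]`_j.

Lemma vec3E q : q = vec3 (q 0 0) (q 0 1) (q 0 2).
Proof.
apply/rowP => j; rewrite mxE; case: j => -[|[|[|//]]] lt3 /=;
  by congr (q _ _); apply: val_inj.
Qed.

Lemma vec3_0 a b c : vec3 a b c 0 0 = a. Proof. by rewrite mxE. Qed.
Lemma vec3_1 a b c : vec3 a b c 0 1 = b. Proof. by rewrite mxE. Qed.
Lemma vec3_2 a b c : vec3 a b c 0 2 = c. Proof. by rewrite mxE. Qed.

Lemma det3 (A : 'M[R]_3) :
  \det A = A 0 0 * (A 1 1 * A 2 2 - A 1 2 * A 2 1)
         - A 0 1 * (A 1 0 * A 2 2 - A 1 2 * A 2 0)
         + A 0 2 * (A 1 0 * A 2 1 - A 1 1 * A 2 0).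
Proof.
(* Indexing by natural numbers makes the lifted ordinals of the cofactor expansion computable. *)
pose B m n := A (inord m) (inord n).
have AE (i j : 'I_3) : A i j = B i j by rewrite /B !inord_val.
have e1 : (1 : 'I_3) = 1%N :> nat by [].
have e2 : (2 : 'I_3) = 2%N :> nat by [].
rewrite (expand_det_row _ 0) !big_ord_recl big_ord0 /cofactor.
rewrite !(expand_det_row _ 0) !big_ord_recl !big_ord0 /cofactor !det_mx11.
by rewrite !mxE !AE e1 e2 /bump /=; ring.
Qed.

(** The number e is the Jacobian determinant of F at q, expressed through [pullback]. *)
Definition volume_factor F q e :=
  differentiable F q /\ forall W, pullback F q (@vol R) W = e * @vol R W.

Lemma volume_factor_comp F E q e1 e2 : volume_factor F q e1 ->
  volume_factor E (F q) e2 -> volume_factor (E \o F) q (e2 * e1).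
Proof.
move=> [dF F1] [dE E2]; split; first exact: differentiable_comp.
move=> W; rewrite -mulrA -F1 -E2 /pullback; congr (vol _); apply/funext => i.
have /funeqP/(_ (W i)) := diff_comp dF dE; exact.
Qed.

Lemma is_diff_vec3 q (f g h df dg dh : 'rV[R]_3 -> R) :
  is_diff q f df -> is_diff q g dg -> is_diff q h dh ->
  is_diff q (fun x => vec3 (f x) (g x) (h x))
    (fun w => vec3 (df w) (dg w) (dh w)).
Proof.
move=> [fd fv] [gd gv] [hd hv].
have vE (a b c : R) : vec3 a b c =
    a *: vec3 1 0 0 + b *: vec3 0 1 0 + c *: vec3 0 0 1.
  by apply/rowP => -[[|[|[|//]]] lt3]; rewrite !mxE /=; ring.
have -> : (fun x => vec3 (f x) (g x) (h x)) = (fun x => f x *: vec3 1 0 0) +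
    (fun x => g x *: vec3 0 1 0) + (fun x => h x *: vec3 0 0 1).
  by apply/funext => x; rewrite vE.
have -> : (fun x => vec3 (df x) (dg x) (dh x)) = (fun x => df x *: vec3 1 0 0) +
    (fun x => dg x *: vec3 0 1 0) + (fun x => dh x *: vec3 0 0 1).
  by apply/funext => x; rewrite vE.
have scal (k dk : 'rV[R]_3 -> R) (o : 'rV[R]_3) : differentiable k q ->
    'd k q = dk :> (_ -> _) -> is_diff q (fun x => k x *: o) (fun x => dk x *:
      o).
  move=> kd kv; apply: DiffDef; first exact: differentiableZl.
  by rewrite diffZl // kv.
have fgd := is_diffD (scal _ _ (vec3 1 0 0) fd fv) (scal _ _ (vec3 0 1 0) gd
  gv).
exact: is_diffD fgd (scal _ _ _ hd hv).
Qed.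

Lemma is_diff_coord q (i : 'I_3) : is_diff q (fun x => x 0 i) (fun w => w 0 i).
Proof.
have @f : {linear 'rV[R]_3 -> R}.
  by exists (fun N : 'rV[R]_3 => N 0 i); do 2![eexists]; do ?[constructor];
     rewrite ?mxE// => ? *; rewrite ?mxE//; move=> ?; rewrite !mxE.
have fc : continuous f by exact: coord_continuous.
apply: DiffDef; first exact: (linear_differentiable q fc).
exact: (diff_lin q fc).
Qed.

Section ScalarFunctions.
Variable q : 'rV[R]_3.
Implicit Types f g df dg : 'rV[R]_3 -> R.

Lemma is_diff_ext f df dg :
  is_diff q f df -> (forall w, df w = dg w) -> is_diff q f dg.
Proof. by move=> dfq /funext <-. Qed.

(** This rule and the next ones are put in pointwise form, so that they combine into the coordinates
    of [advance], [mirror] and [retro]. *)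
Lemma is_diff_const (k : R) : is_diff q (fun=> k) (fun=> 0).
Proof. exact: is_diff_cst. Qed.

Lemma is_diff_add f g df dg : is_diff q f df -> is_diff q g dg ->
  is_diff q (fun x => f x + g x) (fun w => df w + dg w).
Proof. exact: is_diffD. Qed.

Lemma is_diff_opp f df : is_diff q f df ->
  is_diff q (fun x => - f x) (fun w => - df w).
Proof. exact: is_diffN. Qed.

Lemma is_diff_mul f g df dg : is_diff q f df -> is_diff q g dg ->
  is_diff q (fun x => f x * g x) (fun w => f q * dg w + g q * df w).
Proof. exact: is_diffM. Qed.

Lemma is_diff_comp1 (h : R -> R) (dh : R) f df : is_diff q f df ->
  is_derive (f q) 1 h dh -> is_diff q (fun x => h (f x)) (fun w => df w * dh).
Proof.
move=> [fd fv] [hd hv]; have /derivable1_diffP hd' := hd.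
apply: DiffDef; first exact: (differentiable_comp fd hd').
have /= -> := diff_comp fd hd'; apply/funext => w /=.
by rewrite fv diff1E // derive1E hv.
Qed.

End ScalarFunctions.

(** The new angle depends on the old angle alone, so the Jacobian matrix is block triangular and its
    determinant is that of the (x, y) block times e. *)
Lemma volume_factorP F q (a b c a' b' c' e : R) :
  is_diff q F (fun w => vec3 (a * w 0 0 + b * w 0 1 + c * w 0 2)
    (a' * w 0 0 + b' * w 0 1 + c' * w 0 2) (e * w 0 2)) ->
  volume_factor F q (e * (a * b' - b * a')).
Proof.
move=> [Fd Fv]; split=> // W; rewrite /pullback /vol Fv !det3 !mxE /=.
by ring.
Qed.

Definition advance (t : R) q :=
  vec3 (q 0 0 + t * cos (q 0 2)) (q 0 1 + t * sin (q 0 2)) (q 0 2).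

Lemma advance_factor t q : volume_factor (advance t) q 1.
Proof.
have -> : 1 = 1 * (1 * 1 - 0 * 0) :> R by ring.
have dc i := is_diff_coord q i.
apply: (@volume_factorP _ _ 1 0 (- t * sin (q 0 2)) 0 1 (t * cos (q 0 2)) 1).
apply: is_diff_vec3.
- apply: is_diff_ext; first exact: (is_diff_add (dc 0) (is_diff_mul
    (is_diff_const q t) (is_diff_comp1 (dc 2) (is_derive_cos _)))).
  by move=> w /=; ring.
- apply: is_diff_ext; first exact: (is_diff_add (dc 1) (is_diff_mul
    (is_diff_const q t) (is_diff_comp1 (dc 2) (is_derive_sin _)))).
  by move=> w /=; ring.
- by apply: (is_diff_ext (dc 2)) => w /=; ring.
Qed.

(* psi is twice the angle of the axis, which passes through z. *)
Definition mirror (z : R * R) (psi : R) q :=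
  vec3 (z.1 + (cos psi * (q 0 0 - z.1) + sin psi * (q 0 1 - z.2)))
    (z.2 + (sin psi * (q 0 0 - z.1) - cos psi * (q 0 1 - z.2))) (psi - q 0 2).

Lemma mirror_factor z psi q : volume_factor (mirror z psi) q 1.
Proof.
have -> : 1 = -1 * (cos psi * (- cos psi) - sin psi * sin psi) :> R.
  by rewrite -[LHS](cos2Dsin2 psi); ring.
have dc i := is_diff_coord q i; have dk := is_diff_const q.
have dz (a : R) i := is_diff_add (dc i) (is_diff_opp (dk a)).
apply: (@volume_factorP _ _ _ _ 0 _ _ 0 _).
apply: is_diff_vec3.
- apply: (is_diff_ext (is_diff_add (dk z.1) (is_diff_add
    (is_diff_mul (dk (cos psi)) (dz z.1 0))
    (is_diff_mul (dk (sin psi)) (dz z.2 1))))) => w /=.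
  by ring.
- apply: (is_diff_ext (is_diff_add (dk z.2) (is_diff_add
    (is_diff_mul (dk (sin psi)) (dz z.1 0))
    (is_diff_opp (is_diff_mul (dk (cos psi)) (dz z.2 1)))))) => w /=.
  by ring.
- apply: (is_diff_ext (is_diff_add (dk psi) (is_diff_opp (dc 2)))) => w /=.
  by ring.
Qed.

(* q stands for its line, parametrized by time.  It meets the vertical line of
   abscissa a at time h = (a - x) / cos theta, at the height y + h sin theta;
   the line of velocity (cos theta, - sin theta) through that point at that time
   was at the height y + 2 h sin theta at time 0. *)
Definition retro (a k : R) q :=
  vec3 (q 0 0 + k) (q 0 1 + 2 * ((a - q 0 0) * tan (q 0 2))) (- q 0 2).

Lemma retro_factor a k q : cos (q 0 2) != 0 -> volume_factor (retro a k) q (-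
  1).
Proof.
move=> cn0.
have dc i := is_diff_coord q i; have dk := is_diff_const q.
(* The derivative of the tangent. It only enters the derivative of the height with respect to the
   angle, an entry that the determinant does not see. *)
set m := (cos (q 0 2)) ^- 2.
have -> : - 1 = -1 * (1 * 1 - 0 * (- 2 * tan (q 0 2))) :> R by ring.
apply: (@volume_factorP _ _ _ _ 0 _ _ (2 * (a - q 0 0) * m) _).
apply: is_diff_vec3.
- apply: (is_diff_ext (is_diff_add (dc 0) (dk k))) => w /=.
  by ring.
- apply: (is_diff_ext (is_diff_add (dc 1) (is_diff_mul (dk 2)
    (is_diff_mul (is_diff_add (dk a) (is_diff_opp (dc 0)))
      (is_diff_comp1 (dc 2) (is_derive_tan cn0)))))) => w /=.
  by rewrite -/m; ring.
- by apply: (is_diff_ext (is_diff_opp (dc 2))) => w /=; ring.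
Qed.

End VolumeFactor.

(** * Lines run at unit speed *)

Section Lines.
Variable R : realType.
Implicit Types (p : 'rV[R]_3) (e v : R * R) (l : R).

Definition velocity p : R * R := direction (angle p).

Definition line p l : R * R := xy p + l *: velocity p.

(** The time l at which [line p l] meets the line through v of direction e, found by solving an
    equation affine in l. It is meaningful when the two directions are not parallel; otherwise the
    division by 0 gives 0. *)
Definition hitting e v p : R := - cross e (xy p - v) / cross e (velocity p).

Lemma lineD p l k : line p (l + k) = line p l + k *: velocity p.
Proof. by rewrite /line scalerDl addrA. Qed.

Lemma dot_velocity p : dot (velocity p) (velocity p) = 1.
Proof. by rewrite -(cos2Dsin2 (angle p)) /dot -!expr2. Qed.

Lemma xy_advance p l : xy (advance l p) = line p l.
Proof. by apply: eq_coord; rewrite /= ?vec3_0 ?vec3_1. Qed.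

Lemma angle_advance p l : angle (advance l p) = angle p.
Proof. by rewrite /angle vec3_2. Qed.

Section Convergence.
Variables (I : Type) (F : set_system I).
Context {FF : Filter F}.

Lemma cvg_xy (f : I -> 'rV[R]_3) p : f @ F --> p -> xy (f i) @[i --> F] --> xy
  p.
Proof.
move=> fp; apply: cvg_prod2 => /=.
  exact: (cvg_comp f (fun x : 'rV[R]_3 => x 0 0) fp (@coord_continuous _ _ _ _
    _ _)).
exact: (cvg_comp f (fun x : 'rV[R]_3 => x 0 1) fp (@coord_continuous _ _ _ _ _
  _)).
Qed.

Lemma cvg_angle (f : I -> 'rV[R]_3) p :
  f @ F --> p -> angle (f i) @[i --> F] --> angle p.
Proof.
move=> fp.
exact: (cvg_comp f (fun x : 'rV[R]_3 => x 0 2) fp (@coord_continuous _ _ _ _ _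
  _)).
Qed.

Lemma cvg_velocity (f : I -> 'rV[R]_3) p :
  f @ F --> p -> velocity (f i) @[i --> F] --> velocity p.
Proof.
move=> /cvg_angle fp; apply: cvg_prod2 => /=.
  exact: (cvg_comp _ _ fp (@continuous_cos _ _)).
exact: (cvg_comp _ _ fp (@continuous_sin _ _)).
Qed.

Lemma cvg_line (f : I -> 'rV[R]_3) (g : I -> R) p l :
  f @ F --> p -> g @ F --> l -> line (f i) (g i) @[i --> F] --> line p l.
Proof.
by move=> fp gl; apply: cvgD; [exact: cvg_xy|apply: cvgZ => //;
  exact: cvg_velocity].
Qed.

Lemma cvg_cross_velocity e (a : R) (f : I -> 'rV[R]_3) p : f @ F --> p ->
  a * cross e (velocity (f i)) @[i --> F] --> a * cross e (velocity p).
Proof.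
move=> fp; apply: cvgM; first exact: cvg_cst.
by apply: cvg_cross; [exact: cvg_cst|exact: cvg_velocity].
Qed.

Lemma cvg_hitting e v (f : I -> 'rV[R]_3) p : cross e (velocity p) != 0 ->
  f @ F --> p -> hitting e v (f i) @[i --> F] --> hitting e v p.
Proof.
move=> c0 fp; apply: cvgM; last first.
  by apply: cvgV => //; apply: cvg_cross; [exact: cvg_cst|exact: cvg_velocity].
apply: cvgN; apply: cvg_cross; first exact: cvg_cst.
by apply: cvgB; [exact: cvg_xy|exact: cvg_cst].
Qed.

End Convergence.

Lemma cross_line e v p l : cross e (velocity p) != 0 ->
  cross e (line p l - v) = (l - hitting e v p) * cross e (velocity p).
Proof.
move=> c0; rewrite mulrBl /hitting divfK // opprK.
by rewrite /cross /line !coordE; ring.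
Qed.

Lemma hitting_eq e v p l : cross e (velocity p) != 0 ->
  cross e (line p l - v) = 0 -> hitting e v p = l.
Proof.
move=> c0; rewrite cross_line // => /eqP; rewrite mulf_eq0 (negPf c0) orbF.
by rewrite subr_eq0 => /eqP.
Qed.

Lemma cross_hitting e v p : cross e (velocity p) != 0 ->
  cross e (line p (hitting e v p) - v) = 0.
Proof. by move=> c0; rewrite cross_line // subrr mul0r. Qed.

(** Tube lemma: the condition is open in the pair of time and line, and the time interval is
    compact. *)
Lemma near_line_open (O : set (R * R)) p0 (a b : R) : open O ->
  (forall l, a <= l <= b -> O (line p0 l)) ->
  \forall p \near p0, forall l, a <= l <= b -> O (line p l).
Proof.
move=> opO abO.
have /compact_near_coveringP cab := @segment_compact R a b.
have := @cab _ (nbhs p0) (fun p l => O (line p l)) _ _.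
have hyp : forall x : R, `[a, b]%classic x ->
    \forall x' \near x & p \near p0, O (line p x').
  move=> l /=; rewrite in_itv /= => /abO Ol.
  have cl : line i.2 i.1 @[i --> filter_prod (nbhs l) (nbhs p0)] --> line p0 l.
    by apply: cvg_line; [exact: cvg_snd|exact: cvg_fst].
  by apply: cl; exact: open_nbhs_nbhs.
move=> /(_ _ hyp); apply: filterS => p abp l lab.
by apply: abp; rewrite /= in_itv.
Qed.

Lemma unit_angle (a b : R) : a ^+ 2 + b ^+ 2 = 1 ->
  exists psi, cos psi = a /\ sin psi = b.
Proof.
move=> ab.
have a1 : -1 <= a <= 1 by apply/andP; split; nra.
have ca : cos (acos a) = a by apply: acosK; rewrite in_itv.
have sa : sin (acos a) = `|b| by rewrite sin_acos // -sqrtr_sqr;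
  congr Num.sqrt; lra.
have [b0|b0] := leP 0 b; first by exists (acos a); rewrite sa ger0_norm.
by exists (- acos a); rewrite cosN sinN sa ltr0_norm // opprK.
Qed.

Lemma reflect_angle e : e != 0 -> exists psi, forall u : R * R,
  Defs.reflect e u = (cos psi * u.1 + sin psi * u.2, sin psi * u.1 - cos psi *
    u.2).
Proof.
move=> /dot_gt0; set d := dot e e => /lt0r_neq0 d0.
(* The cosine and the sine of twice the angle of e, by the double angle formulas. *)
have [|psi [cE sE]] := @unit_angle ((e.1 ^+ 2 - e.2 ^+ 2) / d) (2 * e.1 * e.2 /
  d).
  apply: (mulIf (expf_neq0 2 d0)); rewrite mulrDl -!exprMn !mulfVK //.
  by rewrite /d /dot; ring.
exists psi => u; rewrite cE sE.
by apply: eq_coord; rewrite /Defs.reflect !coordE /=; apply: (mulIf d0);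
  rewrite /d /dot; field; move: d0; rewrite /d /dot.
Qed.

End Lines.

(** * Trajectories near an endpoint of a free leg *)

Section EndPoints.
Variables (R : realType) (D : andreev_billiard R) (s : bool).
Variables (i : 'I_(nverts D)) (p0 : 'rV[R]_3) (t : R).
Implicit Types (p : 'rV[R]_3) (sgm : R).
Let z := line p0 t.
Let e := edge (@vert R D s) i.
Let v := @vert R D s i.
Hypothesis iz : side (@vert R D s) i z.
Hypothesis nz : ~ corner D s z.

Lemma line_side : cross e (z - v) = 0.
Proof.
have [[h _] _ _] := nbhs_singleton (near_side (@vert_simple R D s) iz nz).
by apply: h; exists i.
Qed.

(** The sign [sgm] is 1 for a leg that leaves z at time t and -1 for a leg that arrives there, so
    that both are treated at once; [d0] is a duration of free motion on that leg. *)
Variables (sgm d0 : R).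
Hypothesis sgm1 : sgm ^+ 2 = 1.
Hypothesis d0_gt0 : 0 < d0.
Hypothesis free : forall k : R, 0 < k < d0 ->
  interior (Omega D s) (line p0 (t + sgm * k)).

Let lineE k : line p0 (t + sgm * k) = z + k *: (sgm *: velocity p0).
Proof. by rewrite lineD scalerA mulrC. Qed.

(* Otherwise the trajectory would run along the side i near z. *)
Lemma side_transverse : cross e (velocity p0) != 0.
Proof.
apply/eqP => c0.
have [k kd [[_ h] _ _]] := small_step (sgm *: velocity p0) d0_gt0
  (near_side (@vert_simple R D s) iz nz).
apply: (interior_bnd (free kd)); rewrite lineE; apply: h.
have -> : cross e (z + k *: (sgm *: velocity p0) - v) =
    cross e (z - v) + k * sgm * cross e (velocity p0).
  by rewrite /cross !coordE; ring.
by rewrite line_side c0 mulr0 addr0.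
Qed.

Lemma hitting0 : hitting e v p0 = t.
Proof. exact: hitting_eq side_transverse line_side. Qed.

Lemma cvg_hitting0 : hitting e v p @[p --> p0] --> t.
Proof.
have := @cvg_hitting R _ (nbhs p0) _ e v id p0 side_transverse cvg_id.
by rewrite hitting0; apply.
Qed.

(** The trajectory of [p0] runs in one half-disk at z. By continuity nearby lines cross the side in
    the same sense, hence run in the same half-disk, for a duration d that does not depend on p. *)
Lemma near_endpoint : exists2 d : R, 0 < d &
  \forall p \near p0, forall k : R, 0 < k < d ->
    interior (Omega D s) (line p (hitting e v p + sgm * k)).
Proof.
have [r r0 half] := near_half_disk (@vert_simple R D s) (@Omega_closed R D s)
  (@Omega_bnd R D s) iz nz.
(* A reference point of the half-disk, on the trajectory of [p0], with which the points of the
   nearby lines are compared. *)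
have [k0 k0d k0r] := small_step (sgm *: velocity p0) d0_gt0 (nbhsx_ballx z r
  r0).
have c0 := side_transverse.
have near_r : \forall l \near t & p \near p0, ball z r (line p l).
  have cl : line i.2 i.1 @[i --> filter_prod (nbhs t) (nbhs p0)] --> z.
    by apply: cvg_line; [exact: cvg_snd|exact: cvg_fst].
  by apply: cl; exact: nbhsx_ballx.
case: near_r => -[A B] /= [/nbhs_ballP[d /= dpos dA] nB] AB.
exists (d / 2); first by rewrite divr_gt0.
have cc : cross e (velocity p0) * cross e (velocity p) @[p --> p0]
    --> cross e (velocity p0) * cross e (velocity p0).
  exact: (@cvg_cross_velocity R _ (nbhs p0) _ e _ id p0 cvg_id).
near=> p => k /andP[kpos kd].
have Bp : B p by near: p; exact: nB.
have ccp : 0 < cross e (velocity p0) * cross e (velocity p).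
  near: p; apply: (cvgr_gt _ cc).
  by rewrite -expr2 lt_neqAle sqr_ge0 andbT eq_sym sqrf_eq0.
have cp : cross e (velocity p) != 0.
  by apply: contraTneq ccp => ->; rewrite mulr0 ltxx.
have hp : `|t - hitting e v p| < d / 2.
  near: p; have /cvgrPdist_lt := cvg_hitting0; apply.
  by rewrite divr_gt0.
apply: (half _ _ k0r).
- apply: (AB (_, _)); split => //=; apply: dA; rewrite /ball /= opprD addrA.
  rewrite (le_lt_trans (ler_normB _ _)) // [ltRHS]splitr ltrD //.
  rewrite normrM (gtr0_norm kpos); have -> : `|sgm| = 1; last by rewrite mul1r.
  by apply/eqP; rewrite -sqr_norm_eq1 // sgm1.
- by rewrite -lineE; apply: free.
rewrite -lineE -/e -/v !cross_line // hitting0 addrC addKr [X in X - _]addrC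
  addrK.
rewrite mulrACA mulr_gt0 // mulrACA -expr2 sgm1 mul1r mulr_gt0 //.
by case/andP: k0d.
Unshelve. all: by end_near. Qed.

End EndPoints.

(** * Stability of orbits *)

Section Perturbation.
Variables (R : realType) (D : andreev_billiard R).
Implicit Types (p x : 'rV[R]_3) (s : bool) (t l : R) (i : 'I_(nverts D)).

Local Notation side_hitting s i :=
  (hitting (edge (@vert R D s) i) (@vert R D s i)).
Local Notation transverse s i p := (cross (edge (@vert R D s) i) (velocity p)
  != 0).
Local Notation on_line s i y :=
  (cross (edge (@vert R D s) i) (y - @vert R D s i) = 0).

(** Just after the bounce [near_endpoint] applies, uniformly in p. From t + d / 2 to [t1] the times
    form a compact interval of free motion, and [near_line_open] applies. *)
Lemma near_leg s i p0 t t' t1 :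
  side (@vert R D s) i (line p0 t) -> ~ corner D s (line p0 t) -> 0 < t' ->
  (forall l, 0 < l < t' -> interior (Omega D s) (line p0 (t + l))) ->
  t1 < t + t' ->
  \forall p \near p0, forall l, side_hitting s i p < l <= t1 ->
    interior (Omega D s) (line p l).
Proof.
move=> iz nz t'0 free t1lt.
have free1 k : 0 < k < t' -> interior (Omega D s) (line p0 (t + 1 * k)).
  by rewrite mul1r; apply: free.
have [d d0 near_d] := near_endpoint iz nz (expr1n _ 2) t'0 free1.
have cv := cvg_hitting0 iz nz t'0 free1.
have mid : \forall p \near p0, forall l, t + d / 2 <= l <= t1 ->
    interior (Omega D s) (line p l).
  apply: near_line_open; first exact: open_interior.
  move=> l /andP[l1 l2]; rewrite -(subrKC t l); apply: free.
  by apply/andP; split; lra.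
near=> p => l /andP[hl lt1].
have hp : t - d / 2 < side_hitting s i p.
  by near: p; apply: (cvgr_gt _ cv); lra.
have [ld|dl] := ltP l (t + d / 2).
  have -> : l = side_hitting s i p + 1 * (l - side_hitting s i p) by ring.
  have : 0 < l - side_hitting s i p < d by apply/andP; split; lra.
  move: (l - _); near: p; exact: near_d.
have : t + d / 2 <= l <= t1 by rewrite dl.
move: l {hl lt1 dl}; near: p; exact: mid.
Unshelve. all: by end_near. Qed.

Variables (s0 : bool) (q : 'rV[R]_3).
Hypothesis Oq : interior (Omega D s0) (xy q).

Definition init x : state R := State s0 (xy x) (velocity x).

(* Stability of an orbit at time t, as an invariant of induction: the orbits of
   the points x near q move along line (G x), extended back to time 0, from the
   time T0 x of their last bounce for as long as that line stays in the table,
   which is at least up to any given time before t. *)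
Definition tracked t s p :=
  exists G : 'rV[R]_3 -> 'rV[R]_3, exists T0 : 'rV[R]_3 -> R, exists c : R,
  [/\ G q = p /\ volume_factor G q (if s == s0 then 1 else -1),
      c < t,
      \forall x \near q, T0 x < c,
      forall t1, t1 < t -> \forall x \near q, forall l, T0 x < l <= t1 ->
        interior (Omega D s) (line (G x) l) &
      \forall x \near q, forall l, T0 x < l ->
        (forall k, T0 x < k < l -> interior (Omega D s) (line (G x) k)) ->
        ~ singular D s (line (G x) l) ->
        Defs.orbit D (init x) l (State s (line (G x) l) (velocity (G x)))].

Lemma cvg_factor (G : 'rV[R]_3 -> 'rV[R]_3) e : volume_factor G q e ->
  G @ q --> G q.
Proof. by move=> [/differentiable_continuous]. Qed.

Lemma tracked_start t : 0 < t -> free_motion D s0 (xy q) (velocity q) t ->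
  tracked t s0 q.
Proof.
(* Before any bounce the tracked line is that of x itself, run from time 0; any c strictly between 0
   and t would do. *)
move=> t0 [free _ _]; exists id, (fun=> 0), (t / 2); split.
- split=> //; rewrite eqxx; split; first exact: ex_diff.
  by move=> W; rewrite mul1r /pullback diff_val.
- by lra.
- by near=> x; lra.
- move=> t1 t1t; have mid : \forall x \near q, forall l, 0 <= l <= t1 ->
      interior (Omega D s0) (line x l).
    apply: near_line_open; first exact: open_interior.
    move=> l /andP[]; rewrite le_eqVlt => /orP[/eqP<- _|l0 lt1].
      by rewrite /line scale0r addr0.
    by apply: free; rewrite l0 (le_lt_trans lt1).
  near=> x => l /andP[l0 lt1].
  have : 0 <= l <= t1 by rewrite ltW.
  by move: l {l0 lt1}; near: x.
have nO : \forall x \near q, interior (Omega D s0) (xy x).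
  have xyc : xy x @[x --> q] --> xy q.
    exact: (@cvg_xy R _ (nbhs q) _ id q cvg_id).
  by apply: xyc; apply: open_nbhs_nbhs; split=> //; exact: open_interior.
near=> x => l l0 freel ns.
apply: (@orbit_free _ _ (init x)); first exact: ltW.
split=> //; apply: interior_nonsingular; near: x; exact: nO.
Unshelve. all: by end_near. Qed.

(** The invariant at x = q: the line p is free on ]c, t[. This is the freedom before a bounce that
    [near_endpoint] asks for when [sgm] is -1. *)
Lemma tracked_back t s p : tracked t s p -> exists2 d : R, 0 < d &
  forall k : R, 0 < k < d -> interior (Omega D s) (line p (t + -1 * k)).
Proof.
move=> [G [T0 [c [[<- _] ct T0c Gfree _]]]].
exists (t - c) => [|k /andP[k0 kd]]; first by rewrite subr_gt0.
have tk : t - k < t by lra.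
have := nbhs_singleton (Gfree _ tk); rewrite mulN1r; apply.
by have := nbhs_singleton T0c => ?; apply/andP; split; lra.
Qed.

(** The induction step common to both boundary laws. The map E turns the incoming line into the
    outgoing one: it must keep the time at which side i is met, and prolong the orbit at every
    boundary point near the bounce of q, not only at that bounce. *)
Lemma bounce t t' s s' i p (E : 'rV[R]_3 -> 'rV[R]_3) :
  tracked t s p ->
  side (@vert R D s) i (line p t) -> ~ corner D s (line p t) ->
  ~ singular D s (line p t) ->
  volume_factor E p (if s == s' then 1 else -1) ->
  side (@vert R D s') i (line (E p) t) -> ~ corner D s' (line (E p) t) ->
  0 < t' ->
  (forall l, 0 < l < t' -> interior (Omega D s') (line (E p) (t + l))) ->
  (forall p' h, transverse s i p' -> on_line s i (line p' h) ->
     on_line s' i (line (E p') h)) ->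
  (\forall y \near line p t, forall p' h k x, y = line p' h -> bnd D s y ->
     side (@vert R D s) i y -> ~ corner D s y ->
     transverse s i p' ->
     Defs.orbit D (init x) h (State s y (velocity p')) -> 0 < k ->
     (forall l, 0 < l < k -> interior (Omega D s') (line (E p') (h + l))) ->
     ~ singular D s' (line (E p') (h + k)) ->
     Defs.orbit D (init x) (h + k)
       (State s' (line (E p') (h + k)) (velocity (E p')))) ->
  tracked (t + t') s' (E p).
Proof.
move=> trk iz nz ns Ef iz' nz' t'0 free' Eline Estep.
have [d0 d0_gt0 back] := tracked_back trk.
have [G [T0 [c [[Gq Gf] ct T0c Gfree Gorbit]]]] := trk.
have Gcv := cvg_factor Gf.
have Ef' : volume_factor E (G q) (if s == s' then 1 else -1) by rewrite Gq.
have EGf := volume_factor_comp Gf Ef'.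
have EGcv := cvg_factor EGf; rewrite /= Gq in EGcv; rewrite Gq in Gcv.
have sq1 : (-1 : R) ^+ 2 = 1 by rewrite sqrrN expr1n.
have [d dpos near_d] := near_endpoint iz nz sq1 d0_gt0 back.
have tr := side_transverse iz nz d0_gt0 back.
have hcv := cvg_hitting0 iz nz d0_gt0 back.
have hGcv : side_hitting s i (G x) @[x --> q] --> t by exact: cvg_comp Gcv hcv.
have free1 k : 0 < k < t' -> interior (Omega D s') (line (E p) (t + 1 * k)).
  by rewrite mul1r; apply: free'.
have tr' := side_transverse iz' nz' t'0 free1.
have hcv' := cvg_hitting0 iz' nz' t'0 free1.
have hEcv : side_hitting s' i (E (G x)) @[x --> q] --> t.
  exact: cvg_comp EGcv hcv'.
(* The last bounce of the orbit of x is now where the outgoing line meets side i. Its time tends to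
   t, so a time strictly between t and t + t' serves as c. *)
exists (E \o G), (side_hitting s' i \o (E \o G)), (t + t' / 2); split.
- split; first by rewrite /= Gq.
  move: EGf; congr volume_factor.
  (* The signs multiply: the parity of the change from [s0] to s' is the sum of those from [s0] to s
     and from s to s'. *)
  by case: (s) (s') (s0) => -[] [] /=; ring.
- by lra.
- by apply: (cvgr_lt _ hEcv); lra.
- by move=> t1 t1lt; exact: (EGcv _ (near_leg iz' nz' t'0 free' t1lt)).
have tr_near : \forall x \near q, 0 <
    cross (edge (@vert R D s) i) (velocity p) *
    cross (edge (@vert R D s) i) (velocity (G x)).
  apply: (cvgr_gt _ (@cvg_cross_velocity R _ (nbhs q) _ _ _ G p Gcv)).
  by rewrite -expr2 lt_neqAle sqr_ge0 andbT eq_sym sqrf_eq0.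
have tr_near' : \forall x \near q, 0 <
    cross (edge (@vert R D s') i) (velocity (E p)) *
    cross (edge (@vert R D s') i) (velocity (E (G x))).
  apply: (cvgr_gt _ (@cvg_cross_velocity R _ (nbhs q) _ _ _ _ _ EGcv)).
  by rewrite -expr2 lt_neqAle sqr_ge0 andbT eq_sym sqrf_eq0.
have zcv : line (G x) (side_hitting s i (G x)) @[x --> q] --> line p t.
  exact: (@cvg_line R _ (nbhs q) _ _ _ _ _ Gcv hGcv).
have m0 : Num.max c (t - d / 2) < t by rewrite gt_max ct; lra.
have ns_near := zcv _ (near_nonsingular ns).
have step_near := zcv _ Estep.
have side_near : \forall x \near q, let y := line (G x) (side_hitting s i (G
  x)) in
    [/\ (bnd D s y <-> on_line s i y), (bnd D s y -> side (@vert R D s) i y) &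
      ~ corner D s y].
  exact: (zcv _ (near_side (@vert_simple R D s) iz nz)).
near=> x.
set h := side_hitting s i (G x).
have trx : transverse s i (G x).
  have : 0 < cross (edge (@vert R D s) i) (velocity p) *
    cross (edge (@vert R D s) i) (velocity (G x)) by near: x.
  by apply: contraTneq => ->; rewrite mulr0 ltxx.
have trx' : transverse s' i (E (G x)).
  have : 0 < cross (edge (@vert R D s') i) (velocity (E p)) *
    cross (edge (@vert R D s') i) (velocity (E (G x))) by near: x.
  by apply: contraTneq => ->; rewrite mulr0 ltxx.
have hx := cross_hitting (@vert R D s i) trx; rewrite -/h in hx.
have hE : side_hitting s' i (E (G x)) = h.
  by apply: hitting_eq => //; exact: Eline.
have [bh sd ncx] : [/\ (bnd D s (line (G x) h) <-> on_line s i (line (G x) h)),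
    (bnd D s (line (G x) h) -> side (@vert R D s) i (line (G x) h)) &
    ~ corner D s (line (G x) h)].
  by rewrite /h; near: x; exact: side_near.
move/bh: hx => Bh; have sx := sd Bh.
have T0h : T0 x < h.
  have cx : T0 x < c by near: x.
  by apply: (lt_trans cx); rewrite /h; near: x; exact: (cvgr_gt _ hGcv _ ct).
have oh : Defs.orbit D (init x) h (State s (line (G x) h) (velocity (G x))).
  have orb : forall l, T0 x < l ->
        (forall k, T0 x < k < l -> interior (Omega D s) (line (G x) k)) ->
        ~ singular D s (line (G x) l) ->
        Defs.orbit D (init x) l (State s (line (G x) l) (velocity (G x))).
    by near: x.
  apply: orb => //; last by rewrite /h; near: x; exact: ns_near.
  move=> k /andP[k0 kh].
  (* Up to this time, which is before t, the invariant gives free motion. Later times are within d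
     of the bounce time h, and [near_endpoint] run backwards from h covers them. *)
  have [kl|kl] := leP k (Num.max c (t - d / 2)).
    have : T0 x < k <= Num.max c (t - d / 2) by rewrite k0.
    by move: k {k0 kh kl}; near: x; exact: Gfree.
  move: kl; rewrite gt_max => /andP[_ kl].
  have hlt : h < t + d / 2 by rewrite /h; near: x; apply: (cvgr_lt _ hGcv); lra.
  have -> : k = h + -1 * (h - k) by ring.
  have : 0 < h - k < d by apply/andP; split; lra.
  by rewrite /h; move: (side_hitting s i (G x) - k); near: x;
    exact: (Gcv _ near_d).
move=> l /=; rewrite hE => hl freel nsl.
have lE : l = h + (l - h) by ring.
have stp : forall p' h k x', line (G x) (side_hitting s i (G x)) = line p' h ->
     bnd D s (line (G x) (side_hitting s i (G x))) ->
     side (@vert R D s) i (line (G x) (side_hitting s i (G x))) ->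
     ~ corner D s (line (G x) (side_hitting s i (G x))) ->
     transverse s i p' ->
     Defs.orbit D (init x') h
       (State s (line (G x) (side_hitting s i (G x))) (velocity p')) -> 0 < k ->
     (forall l, 0 < l < k -> interior (Omega D s') (line (E p') (h + l))) ->
     ~ singular D s' (line (E p') (h + k)) ->
     Defs.orbit D (init x') (h + k)
       (State s' (line (E p') (h + k)) (velocity (E p'))).
  by near: x; exact: step_near.
rewrite lE; apply: stp => //; rewrite -?lE ?subr_gt0 //.
by move=> k /andP[k0 kl]; apply: freel; apply/andP; split; lra.
Unshelve. all: by end_near. Qed.

End Perturbation.

(** * The two bounce maps acting on lines *)

Section BounceMaps.
Variable R : realType.
Implicit Types (p : 'rV[R]_3) (e v u : R * R) (l : R).

Lemma reflect_parallel e u : e != 0 -> cross e u = 0 -> Defs.reflect e u = u.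
Proof.
move=> e0 /(cross_eq0 e0) ->; set m := _ / _.
rewrite /Defs.reflect; have -> : dot (m *: e) e = m * dot e e.
  by rewrite /dot !coordE; ring.
rewrite mulrA mulfK ?gt_eqF ?dot_gt0 //.
by apply: eq_coord; rewrite !coordE; ring.
Qed.

Lemma reflect_vertical e u : e != 0 -> e.1 = 0 ->
  Defs.reflect e u = (- u.1, u.2).
Proof.
move=> e0 e1; have e2 : e.2 != 0.
  by apply: contra e0 => /eqP e2; apply/eqP/eq_coord.
apply: eq_coord; rewrite /Defs.reflect !coordE /= /dot e1; first by ring.
by rewrite !mulr0 !add0r; field.
Qed.

Section Mirror.
Variables (e v : R * R) (psi : R).
Hypothesis psiE : forall u : R * R, Defs.reflect e u =
  (cos psi * u.1 + sin psi * u.2, sin psi * u.1 - cos psi * u.2).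

Lemma velocity_mirror p :
  velocity (mirror v psi p) = Defs.reflect e (velocity p).
Proof.
by rewrite psiE /velocity /direction /angle vec3_2 cosB sinB.
Qed.

Lemma line_mirror p l :
  line (mirror v psi p) l = v + Defs.reflect e (line p l - v).
Proof.
rewrite /line velocity_mirror !psiE.
by apply: eq_coord; rewrite !coordE /= ?vec3_0 ?vec3_1; ring.
Qed.

Lemma line_mirror_fix p l : e != 0 -> cross e (line p l - v) = 0 ->
  line (mirror v psi p) l = line p l.
Proof. by move=> e0 c0; rewrite line_mirror reflect_parallel // addrC subrK.
  Qed.

End Mirror.

Lemma velocity_retro (a k : R) e p : e != 0 -> e.1 = 0 ->
  velocity (retro a k p) = - Defs.reflect e (velocity p).
Proof.
move=> e0 e1; rewrite reflect_vertical //.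
rewrite /velocity /direction /angle vec3_2 cosN sinN.
by apply: eq_coord; rewrite !coordE /= ?opprK.
Qed.

(** On the vertical line of abscissa a the mirror of axis c is the translation by 2 c - 2 a, whence
    the value of k. The outgoing line then passes, at the time l of the crossing, through the mirror
    image of the point where the segment is met. *)
Lemma line_retro (a c : R) p l : cos (angle p) != 0 -> (line p l).1 = a ->
  line (retro a (2 * c - 2 * a) p) l = vmirror c (line p l).
Proof.
move=> c0 lE; rewrite /angle in c0.
have aE : a - p 0 0 = l * cos (p 0 2).
  by rewrite -lE /line !coordE /= /angle; ring.
rewrite /line /velocity /direction /angle vec3_2 cosN sinN.
apply: eq_coord; rewrite !coordE /= /GRing.scale /= ?vec3_0 ?vec3_1.
  by move: aE; lra.
by rewrite aE -mulrA [cos _ * tan _]mulrC /tan divfK //; ring.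
Qed.

End BounceMaps.

(** * Stability through each kind of bounce, and along a whole orbit *)

Section Stability.
Variables (R : realType) (D : andreev_billiard R) (s0 : bool) (q : 'rV[R]_3).
Hypothesis Oq : interior (Omega D s0) (xy q).
Implicit Types (p x : 'rV[R]_3) (s : bool) (t l : R) (i : 'I_(nverts D)).

Local Notation transverse s i p := (cross (edge (@vert R D s) i) (velocity p)
  != 0).

Lemma vert_negb s i : @vert R D (~~ s) i = rho D (@vert R D s i).
Proof. by case: s => //=; rewrite /vert /= rhoK. Qed.

Lemma side_rho s i z :
  side (@vert R D s) i z -> side (@vert R D (~~ s)) i (rho D z).
Proof. by move=> /side_vert h; apply/side_vert; rewrite to_sheet_rho. Qed.

Lemma corner_rho s z : ~ corner D s z -> ~ corner D (~~ s) (rho D z).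
Proof. by move=> h /cornerE c; apply: h; apply/cornerE;
  rewrite to_sheet_rho in c. Qed.

Lemma edge_negb s i : edge (@vert R D (~~ s)) i =
  (- (edge (@vert R D s) i).1, (edge (@vert R D s) i).2).
Proof. by rewrite /edge !vert_negb; apply: eq_coord; rewrite !coordE /=;
  ring. Qed.

Lemma tracked_transverse t s p i : tracked D s0 q t s p ->
  side (@vert R D s) i (line p t) -> ~ corner D s (line p t) ->
  transverse s i p.
Proof.
move=> /tracked_back [d d0 back] iz nz.
have := side_transverse iz nz d0 back; exact.
Qed.

(** Near the bounce point the side lies in the Andreev segment, whose points all have the same
    abscissa. *)
Lemma edge_vertical p t s i : side (@vert R D s) i (line p t) ->
  ~ corner D s (line p t) -> Aset D s (line p t) -> ~ singular D s (line p t) ->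
  (edge (@vert R D s) i).1 = 0.
Proof.
move=> iz nz Az ns; set e := edge _ _.
have [a Aa] := @Aset_abscissa R D s.
have both := @filterI _ (nbhs (line p t)) _ _ _
  (near_side (@vert_simple R D s) iz nz) (near_Aset Az ns).
have {}both := both (nbhs_filter _).
have [k /andP[k0 _] [[[_ h] _ _] hA]] := small_step e ltr01 both.
have := Aa _ Az; have /Aa : Aset D s (line p t + k *: e).
  apply: hA; apply: h; rewrite -(line_side iz nz).
  by rewrite /cross !coordE -/e; ring.
rewrite (fstD (line p t)) fstZ => h1 h2; have /eqP : k * e.1 = 0 by lra.
by rewrite mulf_eq0 gt_eqF //= => /eqP.
Qed.

Lemma tracked_reflect t t' s p i : tracked D s0 q t s p ->
  side (@vert R D s) i (line p t) -> ~ corner D s (line p t) ->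
  (bnd D s `\` Aset D s) (line p t) -> 0 < t' ->
  free_motion D s (line p t)
    (Defs.reflect (edge (@vert R D s) i) (velocity p)) t' ->
  exists2 p', tracked D s0 q (t + t') s p' &
    line p' t = line p t /\
    velocity p' = Defs.reflect (edge (@vert R D s) i) (velocity p).
Proof.
move=> trk iz nz Bz t'0 [free ns _].
have e0 := edge_neq0 (@vert_simple R D s) i.
have [psi psiE] := reflect_angle e0.
set v := @vert R D s i; have lineE p1 l1 := @line_mirror_fix _ _ v _ psiE p1 l1
  e0.
have vE := @velocity_mirror _ _ v _ psiE.
have zE := lineE _ _ (line_side iz nz).
exists (mirror v psi p) => //; apply: (bounce (i := i) (s := s)) => //.
- by rewrite eqxx; exact: mirror_factor.
- by rewrite zE.
- by rewrite zE.
- by move=> l; rewrite lineD zE vE; exact: free.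
- by move=> p' h _ h0; rewrite lineE.
(* Boundary points near the bounce are nonsingular and outside the Andreev segment, so they obey the
   same law. *)
near=> y => p' h k x yE bndy sy ny tr orb k0 freek nsk.
have nsy : ~ singular D s y by near: y; exact: near_nonsingular.
have By : (bnd D s `\` Aset D s) y.
  have : bnd D s y -> (bnd D s `\` Aset D s) y by near: y; exact: near_bndD.
  exact.
have yE' : line (mirror v psi p') h = y.
  rewrite lineE -?yE //.
  have [[h0 _] _ _] := nbhs_singleton (near_side (@vert_simple R D s) sy ny).
  exact: h0.
rewrite lineD yE' in nsk *.
apply: (orbit_reflect orb By) => //; first by split=> //; exists i;
  rewrite // vE.
by split=> // l lk; rewrite -yE' -lineD; exact: freek.
Unshelve. all: by end_near. Qed.

Lemma tracked_andreev t t' s p i : tracked D s0 q t s p ->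
  side (@vert R D s) i (line p t) -> ~ corner D s (line p t) ->
  ~ singular D s (line p t) -> Aset D s (line p t) -> 0 < t' ->
  free_motion D (~~ s) (rho D (line p t))
    (- Defs.reflect (edge (@vert R D s) i) (velocity p)) t' ->
  exists2 p', tracked D s0 q (t + t') (~~ s) p' &
    line p' t = rho D (line p t) /\
    velocity p' = - Defs.reflect (edge (@vert R D s) i) (velocity p).
Proof.
move=> trk iz nz ns Az t'0 [free ns' _].
have e0 := edge_neq0 (@vert_simple R D s) i.
have e1 := edge_vertical iz nz Az ns.
set v := @vert R D s i; set e := edge (@vert R D s) i in e0 e1 *.
(* The side is vertical, so its abscissa is [v.1]. *)
pose E := retro v.1 (2 * axis D - 2 * v.1).
have vE p' : velocity (E p') = - Defs.reflect e (velocity p').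
  exact: velocity_retro.
have cosE p' : transverse s i p' -> cos (angle p') != 0.
  by apply: contra => /eqP c0; rewrite /cross -/e e1 mul0r [(velocity p').1]c0
    mulr0 subrr.
have e2 : e.2 != 0.
  by apply: contra e0 => /eqP e2; apply/eqP/eq_coord.
have abscissa y : cross e (y - v) = 0 -> y.1 = v.1.
  rewrite /cross e1 mul0r sub0r => /eqP; rewrite oppr_eq0 mulf_eq0 (negPf e2)
    /=.
  by rewrite subr_eq0 => /eqP.
have lineE p' h : transverse s i p' -> cross e (line p' h - v) = 0 ->
    line (E p') h = rho D (line p' h).
  by move=> /cosE cp /abscissa; exact: line_retro.
have tr := tracked_transverse trk iz nz.
have zE := lineE _ _ tr (line_side iz nz).
exists (E p) => //; apply: (bounce (i := i) (s := s)) => //.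
- have -> : (s == ~~ s) = false by case: (s).
  by apply: retro_factor; exact: cosE.
- by rewrite zE; exact: side_rho.
- by rewrite zE; exact: corner_rho.
- by move=> l; rewrite lineD zE vE; exact: free.
- move=> p' h trp /[dup] /abscissa ab h0;
  rewrite lineE // edge_negb vert_negb -/e -/v.
  move: (line p' h) ab => y ab.
  rewrite /cross /=; move: e1; rewrite /e /edge fstD fstN ab => e1;
    rewrite e1; ring.
have ns'_near : \forall y \near line p t, ~ singular D (~~ s) (rho D y).
  exact: (@to_sheet_continuous R D false _ _ (near_nonsingular ns')).
(* Boundary points near the crossing belong to the Andreev segment, and their mirror images are
   nonsingular. *)
near=> y => p' h k x yE bndy sy ny trp orb k0 freek nsk.
have nsy : ~ singular D (~~ s) (rho D y) by near: y.
have Ay : Aset D s y.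
  have : bnd D s y -> Aset D s y by near: y; exact: near_Aset.
  exact.
have yE' : line (E p') h = rho D y.
  rewrite lineE -?yE //.
  have [[h0 _] _ _] := nbhs_singleton (near_side (@vert_simple R D s) sy ny).
  exact: h0.
rewrite lineD yE' vE in nsk *.
apply: (orbit_andreev orb Ay) => //; first by split=> //; exists i.
by split=> // l lk; rewrite -yE' -vE -lineD; exact: freek.
Unshelve. all: by end_near. Qed.

(** Induction on the orbit. The clause at t = 0 rules out a bounce at time 0, since q is interior,
    so that an invariant is available at every bounce; nonsingularity of the point reached is what
    the next bounce needs. *)
Lemma tracked_orbit t r : Defs.orbit D (init s0 q) t r ->
  [/\ 0 <= t, t = 0 -> r = init s0 q, ~ singular D (sheet r) (pos r) &
    0 < t -> exists2 p, tracked D s0 q t (sheet r) p &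
      r = State (sheet r) (line p t) (velocity p)].
Proof.
have start z s u : State s z u = init s0 q -> ~ bnd D s z.
  by move=> [-> -> _]; exact: interior_bnd.
have sumgt0 (a b : R) : 0 <= a -> 0 < b -> 0 < a + b by move=> ? ?; lra.
elim=> {t r} [t t0 [free n1 n2]|t t' s z u u' _|t t' s z u u' _].
- split=> // [->|tp]; first by rewrite scale0r addr0.
  by exists q => //; apply: tracked_start.
- move=> [t0 t0E /= ns IH] Bz [nz [i iz ->]] t'0 free;
  have tt := sumgt0 _ _ t0 t'0.
  split=> [|tE||_]; [exact: ltW|by rewrite tE ltxx in tt|by case: free|].
  have tp : 0 < t.
    rewrite lt_neqAle t0 andbT; apply/eqP => /esym /t0E /start; apply;
      exact: Bz.1.
  have [p /= trk [zE uE]] := IH tp; subst z u.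
  have [p' trk' [<- <-]] := tracked_reflect trk iz nz Bz t'0 free.
  by exists p' => //=; rewrite lineD.
- move=> [t0 t0E /= ns IH] Az [nz [i iz ->]] t'0 free;
  have tt := sumgt0 _ _ t0 t'0.
  split=> [|tE||_]; [exact: ltW|by rewrite tE ltxx in tt|by case: free|].
  have tp : 0 < t.
    rewrite lt_neqAle t0 andbT; apply/eqP => /esym /t0E /start; apply.
    exact: Aset_bnd.
  have [p /= trk [zE uE]] := IH tp; subst z u.
  have [p' trk' [<- <-]] := tracked_andreev trk iz nz ns Az t'0 free.
  by exists p' => //=; rewrite lineD.
Qed.

(** The time-t map is [advance t] after the tracked line map. Since the point reached is interior,
    nearby trajectories are free up to and including time t: the invariant covers the times up to t
    - d / 2, compactness the rest. *)
Lemma tracked_flow t s p : tracked D s0 q t s p ->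
  interior (Omega D s) (line p t) -> exists F,
  [/\ F q = advance t p, volume_factor F q (if s == s0 then 1 else -1),
    \forall x \near q, interior (Omega D s) (xy (F x)) &
    \forall x \near q,
      Defs.orbit D (init s0 x) t (State s (xy (F x)) (velocity (F x)))].
Proof.
move=> trk Oz; have [d d0 back] := tracked_back trk.
have [G [T0 [c [[Gq Gf] ct T0c Gfree Gorbit]]]] := trk.
have Ff := volume_factor_comp Gf (advance_factor t (G q)); rewrite mul1r in Ff.
have Gcv := cvg_factor Gf; rewrite Gq in Gcv.
have near_end : \forall x \near q, forall l, t - d / 2 <= l <= t ->
    interior (Omega D s) (line (G x) l).
  apply: (Gcv _ (near_line_open (@open_interior _ _) _)) => l /andP[dl].
  rewrite le_eqVlt => /orP[/eqP -> //|lt].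
  have -> : l = t + -1 * (t - l) by ring.
  by apply: back; apply/andP; split; lra.
have tdt : t - d / 2 < t by lra.
have OF : \forall x \near q, interior (Omega D s) (xy (advance t (G x))).
  near=> x; rewrite xy_advance.
  have ht : t - d / 2 <= t <= t by rewrite lexx ltW.
  suff near_t : forall l, t - d / 2 <= l <= t -> interior (Omega D s) (line (G
    x) l).
    exact: near_t.
  by near: x; exact: near_end.
exists (advance t \o G); split=> //; first by rewrite /= Gq.
near=> x; rewrite /= xy_advance.
have -> : velocity (advance t (G x)) = velocity (G x).
  by rewrite /velocity angle_advance.
have T0x : T0 x < c by near: x.
have orb : forall l, T0 x < l ->
    (forall k, T0 x < k < l -> interior (Omega D s) (line (G x) k)) ->
    ~ singular D s (line (G x) l) ->
    Defs.orbit D (init s0 x) l (State s (line (G x) l) (velocity (G x))).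
  by near: x.
have free1 : forall l, T0 x < l <= t - d / 2 -> interior (Omega D s) (line (G
  x) l).
  by near: x; exact: Gfree.
have free2 : forall l, t - d / 2 <= l <= t -> interior (Omega D s) (line (G x)
  l).
  by near: x; exact: near_end.
apply: orb; first exact: lt_trans ct.
  move=> k /andP[k0 kt]; have [kd|dk] := leP k (t - d / 2).
    by apply: free1; rewrite k0.
  by apply: free2; rewrite !ltW.
by apply: interior_nonsingular; apply: free2; rewrite lexx ltW.
Unshelve. all: by end_near. Qed.

End Stability.

(** * A trajectory crossing the Andreev segment *)

Section Crossing.
Variables (R : realType) (D : andreev_billiard R).

Lemma Aset_nonsingular s z : Aset D s z ->
  (\forall y \near z, bnd D s y -> Aset D s y) -> ~ singular D s z.
Proof.
move=> Az nA [/cornerE [i _ iE]|[_ cz]].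
  have [_ _ _ _ nv] := andreev_vertical D; apply: (nv i).
  by rewrite iE; exact/AsetE.
by have [y [[By nAy] /(_ By)]] := cz _ nA.
Qed.

(** The ordinates of the Andreev segment form a connected set, hence an interval; it is not reduced
    to a point because the abscissa is constant. *)
Lemma segment_in_andreev : exists a b c : R, b < c /\
  forall y, b <= y <= c -> andreev D (a, y).
Proof.
have [_ cA [z [w [Az Aw zw]]] [a Aa] _] := andreev_vertical D.
have cI : connected (snd @` andreev D).
  apply: connected_continuous_connected => //.
  by apply: continuous_subspaceT => y; exact: cvg_snd.
have itv := (connected_intervalP _).1 cI.
have between (b c y : R) : (snd @` andreev D) b -> (snd @` andreev D) c ->
    b <= y <= c -> andreev D (a, y).
  move=> Ab Ac bc; have [u Au <-] := itv _ _ Ab Ac _ bc.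
  by rewrite -(Aa u Au) -surjective_pairing.
have Iz : (snd @` andreev D) z.2 by exists z.
have Iw : (snd @` andreev D) w.2 by exists w.
have [lt|lt|e] := ltgtP z.2 w.2.
- by exists a, z.2, w.2; split=> // y; exact: between.
- by exists a, w.2, z.2; split=> // y; exact: between.
- by case: zw; apply: eq_coord => //; rewrite (Aa z Az) (Aa w Aw).
Qed.

(** The point m is a midpoint inside the segment, and the horizontal direction (sgm, 0) points from
    it into the table. *)
Lemma andreev_access : exists m : R * R, exists sgm r : R,
  [/\ sgm ^+ 2 = 1, 0 < r,
      forall s, Aset D s (to_sheet D s m) /\ ~ singular D s (to_sheet D s m),
      exists2 i, side (vertex D) i m & (edge (vertex D) i).1 = 0 &
      forall k, 0 < k < r -> interior (table D) (m + k *: (sgm, 0))].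
Proof.
have [a [b [c [bc Aac]]]] := segment_in_andreev.
have [Apoly _ _ _ nv] := andreev_vertical D.
have sp : simple_polygon (vertex D) by have [] := table_polygonal D.
pose m : R * R := (a, (b + c) / 2).
have Am : andreev D m by apply: Aac; apply/andP; split; lra.
have nm : ~ range (vertex D) m.
  by move=> [i _ iE]; apply: (nv i); rewrite iE.
have [i _ im] := Apoly _ Am.
set e := edge (vertex D) i; set v := vertex D i.
have e0 : e != 0 by exact: edge_neq0.
have near_m := near_side sp im nm.
have cm : cross e (m - v) = 0.
  by have [[h _] _ _] := nbhs_singleton near_m; apply: h; exists i.
(* Points slightly above m are still on the Andreev segment, hence on the line of side i, which is
   therefore vertical. *)
have e1 : e.1 = 0.
  have bc2 : 0 < (c - b) / 2 by lra.
  have [k /andP[k0 kbc] [[h _] _ _]] := small_step (0, 1) bc2 near_m.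
  have : cross e (m + k *: (0, 1) - v) = 0.
    apply: h; apply: Apoly.
    have -> : m + k *: (0, 1) = (a, (b + c) / 2 + k).
      by apply: eq_coord; rewrite !coordE /=; ring.
    by apply: Aac; apply/andP; split; lra.
  have -> : cross e (m + k *: (0, 1) - v) = cross e (m - v) + k * e.1.
    by rewrite /cross !fstD !sndD fstZ sndZ /=; ring.
  by rewrite cm add0r => /eqP; rewrite mulf_eq0 gt_eqF //= => /eqP.
have e2 : e.2 != 0 by apply: contra e0 => /eqP e2; apply/eqP/eq_coord.
have crossE y : cross e (y - v) = - e.2 * (y.1 - a).
  transitivity (cross e (m - v) - e.2 * (y.1 - a)).
    by rewrite /cross e1 !fstD !fstN /=; ring.
  by rewrite cm sub0r mulNr.
have near_A : \forall y \near m, polygon (vertex D) y -> andreev D y.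
  have c2 : y.2 @[y --> m] --> (b + c) / 2.
    exact: (@cvg_proj2 R _ (nbhs m) id m cvg_id).
  near=> y => py.
  have yb : b < y.2 by near: y; apply: (cvgr_gt _ c2); lra.
  have yc : y.2 < c by near: y; apply: (cvgr_lt _ c2); lra.
  have [[cy _] _ _] : [/\ (polygon (vertex D) y <-> cross e (y - v) = 0),
    (polygon (vertex D) y -> side (vertex D) i y) & ~ range (vertex D) y].
    by near: y; exact: near_m.
  have y1 : y.1 = a.
    have := cy py; rewrite crossE => /eqP.
    by rewrite mulf_eq0 oppr_eq0 (negPf e2) subr_eq0 => /eqP.
  by rewrite [y]surjective_pairing y1; apply: Aac; rewrite !ltW.
have Om_bnd : table D `\` interior (table D) = polygon (vertex D).
  by have := @Omega_bnd R D true; rewrite /Omega image_id.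
have clOm : closed (table D).
  by have := @Omega_closed R D true; rewrite /Omega image_id.
have [r r0 half] := near_half_disk sp clOm Om_bnd im nm.
(* The table is the closure of its interior, so some interior point [y1] is near m. The sign of
   [y1.1 - a] tells on which side of the segment the table lies. *)
have [y1 [y1O y1b]] : (interior (table D) `&` (ball m r `&` [set y |
    polygon (vertex D) y <-> cross e (y - v) = 0])) !=set0.
  have [_ [_ clint] _ _] := table_polygonal D.
  have : closure (interior (table D)) m.
    have : polygon (vertex D) m by exists i.
    by rewrite clint -Om_bnd => -[].
  apply; apply: filterI; first exact: nbhsx_ballx.
  by move: near_m; apply: filterS => y [].
have [y1r y1c] := y1b.
have y1a : y1.1 - a != 0.
  apply/eqP => h; apply: (interior_polygon Om_bnd y1O); apply/y1c.
  by rewrite crossE h mulr0.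
exists m, (Num.sg (y1.1 - a)), r; split=> //.
- by rewrite sqr_sg y1a.
- move=> s; have As : Aset D s (to_sheet D s m).
    by apply/AsetE; rewrite to_sheetK.
  split=> //; apply: Aset_nonsingular => //.
  have : \forall y \near to_sheet D s m,
      polygon (vertex D) (to_sheet D s y) -> andreev D (to_sheet D s y).
    have := near_A; rewrite -{1}[m](to_sheetK D s).
    by move=> /(@to_sheet_continuous R D s).
  by apply: filterS => y h /bndE /h /AsetE.
- by exists i.
move=> k /andP[k0 kr]; apply: (half y1) => //.
  split; rewrite /ball /= opprD addNKr ?normrN.
    by rewrite normrM normr_sg y1a mulr1 gtr0_norm.
  by rewrite ?scaler0 ?mulr0 normr0.
rewrite -/e -/v !crossE fstD fstZ /= [a + _]addrC addrK mulrACA mulrNN.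
rewrite mulr_gt0 -?expr2 //; first by rewrite lt_neqAle sqr_ge0 andbT eq_sym
  sqrf_eq0.
rewrite mulrCA mulr_gt0 // mulrC -normrEsg normr_gt0.
Unshelve. all: by end_near. Qed.

(** From a point at distance r / 2 from m, the motion goes perpendicularly to the segment, crosses
    at m at time r / 2, and reaches the mirror image of its starting point at time r. *)
Lemma andreev_crossing : exists (t : R) (q q' : 'rV[R]_3),
  [/\ 0 < t, interior (Omega D true) (xy q), interior (Omega D false) (xy q') &
      flow D t (at_coord D true q) (at_coord D false q')].
Proof.
have [m [sgm [r [sgm1 r0 Am [i im e1] free]]]] := andreev_access.
(* The direction from the table towards m. A crossing at right angles keeps it, so psi is the angle
   of both q and q'. *)
have [psi [cpsi spsi]] : exists psi, cos psi = - sgm /\ sin psi = 0.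
  by apply: unit_angle; rewrite sqrrN sgm1 expr0n addr0.
pose k := r / 2.
have kr : 0 < k < r by rewrite /k; apply/andP; split; lra.
have k0 : 0 < k by case/andP: kr.
pose q := vec3 (m.1 + k * sgm) m.2 psi.
pose q' := vec3 (2 * axis D - (m.1 + k * sgm)) m.2 psi.
have qE : xy q = m + k *: (sgm, 0).
  apply: eq_coord; rewrite /= ?vec3_0 ?vec3_1 //.
  by rewrite scaler0 addr0.
have q'E : xy q' = rho D (m + k *: (sgm, 0)).
  apply: eq_coord; rewrite /= ?vec3_0 ?vec3_1 //.
  by rewrite scaler0 addr0.
have vq : velocity q = (- sgm, 0) by rewrite /velocity /direction /angle vec3_2
  cpsi spsi.
have vq' : velocity q' = (- sgm, 0) by rewrite /velocity /direction /angle
  vec3_2 cpsi spsi.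
have freeO s l : 0 < l < r ->
    interior (Omega D s) (to_sheet D s (m + l *: (sgm, 0))).
  by move=> lr; apply/interior_Omega; rewrite to_sheetK; exact: free.
have Oq : interior (Omega D true) (xy q) by rewrite qE; exact: freeO.
have Oq' : interior (Omega D false) (xy q') by rewrite q'E;
  exact: (freeO false).
have [Amt nst] := Am true; have [_ nsf] := Am false.
have sp : simple_polygon (vertex D) by have [] := table_polygonal D.
have e0 := edge_neq0 sp i.
have nm : ~ corner D true m by move=> c; apply: nst; left.
have u'E : Defs.reflect (edge (vertex D) i) (- sgm, 0) = (sgm, 0).
  by rewrite reflect_vertical //= opprK.
exists (k + k), q, q'; split=> //; first by rewrite addr_gt0.
split; try exact: phase_space_interior (dot_velocity _).
exists (State true (xy q) (velocity q)), (State false (xy q') (velocity q')).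
split; try exact: pclass_refl (dot_velocity _).
have line_back l : xy q + l *: velocity q = m + (k - l) *: (sgm, 0).
  by rewrite qE vq; apply: eq_coord; rewrite !coordE /=; ring.
have start : Defs.orbit D (State true (xy q) (velocity q)) k
    (State true m (velocity q)).
  have -> : m = xy q + k *: velocity q.
    by rewrite line_back subrr scale0r addr0.
  apply: (@orbit_free _ _ (State true (xy q) (velocity q))); first exact: ltW.
  split=> [l /andP[l0 lk]||] /=.
  - by rewrite line_back; apply: (freeO true); apply/andP; split; lra.
  - exact: interior_nonsingular.
  - by rewrite line_back subrr scale0r addr0.
have := @orbit_andreev _ _ _ k k true m (velocity q) (sgm, 0) start Amt.
have forward l : rho D m + l *: - (sgm, 0) = rho D (m + l *: (sgm, 0)).
  by apply: eq_coord; rewrite !coordE /= /GRing.scale /=; ring.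
rewrite forward -q'E (_ : - (sgm, 0) = velocity q'); last first.
  by rewrite vq'; apply: eq_coord; rewrite !coordE /= ?oppr0.
apply=> //; first by split=> //; exists i => //; rewrite vq; exact: (esym u'E).
have vE : velocity q' = - (sgm, 0).
  by rewrite vq'; apply: eq_coord; rewrite !coordE /= ?oppr0.
split=> [l /andP[l0 lk]||] /=.
- by rewrite vE forward; apply: (freeO false); apply/andP; split; lra.
- exact: nsf.
- by rewrite vE forward -q'E; exact: interior_nonsingular.
Qed.

End Crossing.

(** * The flow in coordinates *)

Section Coordinates.
Variable R : realType.
Implicit Types (q x : 'rV[R]_3) (F : 'rV[R]_3 -> 'rV[R]_3).

(** Here a - b is a multiple of 2 pi, which need not be exhibited. *)
Lemma rotate_angle (a b c : R) : cos a = cos b -> sin a = sin b ->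
  direction (c + (a - b)) = direction c.
Proof.
move=> cab sab; rewrite /direction (cosD c) (sinD c) cosB sinB cab sab.
by rewrite -!expr2 cos2Dsin2 [sin b * cos b]mulrC subrr; congr pair; ring.
Qed.

Lemma angle_eq (a b : R) : cos a = cos b -> sin a = sin b -> `|a - b| < pi ->
  a = b.
Proof.
move=> cab sab abpi; have s0 : sin (a - b) = 0.
  by rewrite sinB cab sab mulrC subrr.
apply/eqP; rewrite -subr_eq0 -normr_le0 leNgt; apply/negP => ab0.
have : 0 < sin `|a - b| by apply: sin_gt0_pi; rewrite ab0.
have [_|_] := ler0P (a - b); by rewrite ?sinN s0 ?oppr0 ltxx.
Qed.

(** The differential depends on the germ only; this is read off directional derivatives. *)
Lemma volume_factor_eq F1 F2 q e : volume_factor F1 q e ->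
  differentiable F2 q -> (\near q, F1 q = F2 q) -> volume_factor F2 q e.
Proof.
move=> [d1 f1] d2 F12; split; first exact: d2.
move=> W; rewrite -(f1 W); apply: (f_equal (@vol R)); apply/funext => i.
have e1 := deriveE (W i) d1; have e2 := deriveE (W i) d2.
have e12 := near_eq_derive (W i) F12.
exact: (etrans (esym e2) (etrans (esym e12) e1)).
Qed.

Lemma volume_factor_translate F q e (c : 'rV[R]_3) : volume_factor F q e ->
  volume_factor (fun x => F x + c) q e.
Proof.
move=> [dF fF]; have dc := differentiable_cst (W' := 'rV[R]_3) c q.
split; first exact: (differentiableD dF dc).
move=> W; rewrite -(fF W); apply: (f_equal (@vol R)); apply/funext => i.
have eD := congr1 (fun f => f (W i)) (diffD dF dc).
have e0 := congr1 (fun f => f (W i)) (diff_cst (V := 'rV[R]_3) c q).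
exact: (etrans eD (etrans (congr1 (+%R ('d F q (W i))) e0) (addr0 _))).
Qed.

Lemma vol_neq0 : exists W, @vol R W != 0.
Proof.
exists (fun i => delta_mx 0 i); rewrite /vol.
have -> : \matrix_i (delta_mx 0 i : 'rV[R]_3) = 1%:M.
  by apply/matrixP => i j; rewrite !mxE eqxx eq_sym.
by rewrite det1 oner_neq0.
Qed.

End Coordinates.

Section FlowInCoordinates.
Variables (R : realType) (D : andreev_billiard R).

Lemma flow_orbit (t : R) s s' (q q' : 'rV[R]_3) :
  interior (Omega D s) (xy q) -> interior (Omega D s') (xy q') ->
  flow D t (at_coord D s q) (at_coord D s' q') ->
  Defs.orbit D (init s q) t (State s' (xy q') (velocity q')).
Proof.
move=> Oq Oq' [_ _ [p [r [/(pclass_interior Oq) -> /(pclass_interior Oq')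
  ->]]]].
exact.
Qed.

Lemma orbit_flow (t : R) s s' (q q' : 'rV[R]_3) :
  interior (Omega D s) (xy q) -> interior (Omega D s') (xy q') ->
  Defs.orbit D (init s q) t (State s' (xy q') (velocity q')) ->
  flow D t (at_coord D s q) (at_coord D s' q').
Proof.
move=> Oq Oq' orb; split; try exact: phase_space_interior (dot_velocity _).
exists (init s q), (State s' (xy q') (velocity q')).
by split=> //; exact: pclass_refl (dot_velocity _).
Qed.

Lemma near_interior s (I : Type) (F : set_system I) (FF : Filter F)
    (f : I -> 'rV[R]_3) q :
  f @ F --> q -> interior (Omega D s) (xy q) ->
  \forall x \near F, interior (Omega D s) (xy (f x)).
Proof.
move=> fq Oq; have xyc := cvg_xy fq; apply: xyc.
by apply: open_nbhs_nbhs; split=> //; exact: open_interior.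
Qed.

Lemma coord_expr_exists (t : R) s s' (q q' : 'rV[R]_3) : 0 < t ->
  interior (Omega D s) (xy q) -> interior (Omega D s') (xy q') ->
  flow D t (at_coord D s q) (at_coord D s' q') ->
  exists F, coord_expr D t s q s' q' F /\
    volume_factor F q (if s' == s then 1 else -1).
Proof.
move=> t0 Oq Oq' /(flow_orbit Oq Oq') /(tracked_orbit Oq) [_ _ _ /(_ t0)].
move=> [p /= trk rE].
have zE : xy q' = line p t := congr1 (@pos R) rE.
have uE : velocity q' = velocity p := congr1 (@dir R) rE.
have Oz := Oq'; rewrite zE in Oz.
have [F [Fq Ff OF orbF]] := tracked_flow trk Oz.
have xyF : xy (F q) = xy q' by rewrite Fq xy_advance.
have [cF sF] : cos (angle q') = cos (angle (F q)) /\
    sin (angle q') = sin (angle (F q)).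
  by move: uE; rewrite Fq angle_advance => -[-> ->].
(* The tracked map may end at an angle that differs from that of q' by a multiple of 2 pi. A
   constant translation corrects it without changing the Jacobian. *)
pose c := vec3 0 0 (angle q' - angle (F q)).
have xyE x : xy (F x + c) = xy (F x).
  by apply: eq_coord; rewrite /= mxE ?vec3_0 ?vec3_1 addr0.
have velE x : velocity (F x + c) = velocity (F x).
  rewrite -[RHS](rotate_angle _ cF sF) /velocity; congr direction.
  by rewrite /angle mxE vec3_2.
have Ff' := volume_factor_translate c Ff.
exists (fun x => F x + c); split; last exact: Ff'.
have xyFc := etrans (xyE q) xyF.
split.
- rewrite [q']vec3E [F q + c]vec3E.
  congr vec3; [exact: (congr1 fst xyFc)|exact: (congr1 snd xyFc)|].
  by rewrite mxE vec3_2 /angle addrC subrK.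
- by case: Ff'.
have Ox : \forall x \near q, interior (Omega D s) (xy x).
  exact: (@near_interior _ _ (nbhs q) _ id q cvg_id Oq).
near=> x; apply: orbit_flow.
- by near: x.
- by rewrite xyE; near: x.
- by rewrite xyE velE; near: x.
Unshelve. all: by end_near. Qed.

(** By determinism both expressions give the same position and direction near q. Their angles both
    tend to that of q', so they end up less than pi apart and are equal. *)
Lemma coord_expr_unique (t : R) s s' (q q' : 'rV[R]_3) F1 F2 :
  interior (Omega D s) (xy q) -> interior (Omega D s') (xy q') ->
  coord_expr D t s q s' q' F1 -> coord_expr D t s q s' q' F2 ->
  \near q, F1 q = F2 q.
Proof.
move=> Oq Oq' [F1q d1 flow1] [F2q d2 flow2].
have c1 : F1 @ q --> q' by rewrite -F1q; exact: differentiable_continuous.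
have c2 : F2 @ q --> q' by rewrite -F2q; exact: differentiable_continuous.
have Ox : \forall x \near q, interior (Omega D s) (xy x).
  exact: (@near_interior _ _ (nbhs q) _ id q cvg_id Oq).
have O1 := @near_interior s' _ (nbhs q) (nbhs_filter q) F1 q' c1 Oq'.
have O2 := @near_interior s' _ (nbhs q) (nbhs_filter q) F2 q' c2 Oq'.
have a12 : angle (F1 x) - angle (F2 x) @[x --> q] --> angle q' - angle q'.
  exact: (cvgB (@cvg_angle R _ (nbhs q) _ _ c1) (@cvg_angle R _ (nbhs q) _ _
    c2)).
near=> x.
have Oxx : interior (Omega D s) (xy x) by near: x.
have orb1 : Defs.orbit D (init s x) t (State s' (xy (F1 x)) (velocity (F1 x))).
  by apply: flow_orbit => //; near: x.
have orb2 : Defs.orbit D (init s x) t (State s' (xy (F2 x)) (velocity (F2 x))).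
  by apply: flow_orbit => //; near: x.
have [xE yE cE sE] := orbit_inj (p := init s x) Oxx orb1 orb2.
rewrite [F1 x]vec3E [F2 x]vec3E; congr vec3 => //.
apply: angle_eq => //; near: x.
by move: a12; rewrite subrr => /cvgr0Pnorm_lt; apply; exact: pi_gt0.
Unshelve. all: by end_near. Qed.

(** All coordinate expressions share one germ at q, so the Jacobian computed for one of them holds
    for all; it is -1 as the sheets differ. *)
Lemma andreev_pullback (t : R) (q q' : 'rV[R]_3) : 0 < t ->
  interior (Omega D true) (xy q) -> interior (Omega D false) (xy q') ->
  flow D t (at_coord D true q) (at_coord D false q') ->
  (exists F, coord_expr D t true q false q' F) /\
  (forall F, coord_expr D t true q false q' F ->
     forall w, pullback F q (@vol R) w = - @vol R w).
Proof.
move=> t0 Oq Oq' fl; have [F0 [F0e F0f]] := coord_expr_exists t0 Oq Oq' fl.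
split; first by exists F0.
move=> F Fe W; have [_ dF _] := Fe.
have [_ ->] := volume_factor_eq F0f dF (coord_expr_unique Oq Oq' F0e Fe).
by rewrite mulN1r.
Qed.

End FlowInCoordinates.

(* q = (x, y, theta) and q' = (x', y', theta') *)
Theorem theorem1 (R : realType) (D : andreev_billiard R) :
  ~ volume_preserved D /\
  (forall (t : R) (q q' : 'rV[R]_3), 0 < t ->
     interior (Omega D true) (xy q) -> interior (Omega D false) (xy q') ->
     flow D t (at_coord D true q) (at_coord D false q') ->
     (exists F, coord_expr D t true q false q' F) /\
     (forall F, coord_expr D t true q false q' F ->
        forall w, pullback F q (@vol R) w = - @vol R w)).
Proof.
split; last exact: andreev_pullback.
move=> pres; have [t [q [q' [t0 Oq Oq' fl]]]] := andreev_crossing D.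
have [[F Fe] /(_ F Fe) Fpull] := andreev_pullback t0 Oq Oq' fl.
(* On a frame of nonzero volume the form cannot equal its opposite. *)
have [W /eqP] := @vol_neq0 R; apply.
have := pres _ _ _ _ _ _ t0 Oq Oq' Fe W; rewrite Fpull.
by move=> ?; lra.
Qed.
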